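(* Under the standing setup below, there exist positive real numbers $r_0,\varepsilon_m,K$ and $\varepsilon_0$ (with $\varepsilon_0$ sufficiently small) such that, for every $\theta\in\mathbb R$, the following hold, where $j$ ranges over the (finitely many) integers with $U_j^\theta\neq\emptyset$ and $V_j^\theta:=B_{\varepsilon_m}(U_j^\theta)$: (PRE) the sets $U_j^\theta$ are pairwise disjoint open subsets of $\Omega$, $\overline{U_j^\theta}\subset V_j^\theta$, and $T_j^\theta:V_j^\theta\to\mathbb R^k$ is $C^2$; (PE1) $T_\theta|_{U_j^\theta}=T_j^\theta|_{U_j^\theta}$ and $B_{r_0}(T_\theta(U_j^\theta))\subset T_j^\theta(V_j^\theta)$; (PE2) $T_j^\theta$ is a $C^2$ diffeomorphism of $V_j^\theta$ onto its image, and for all $\varepsilon\in(0,\varepsilon_0)$, all $z\in T_j^\theta(V_j^\theta)$ and all $x,y\in B(z,\varepsilon)\cap T_j^\theta(V_j^\theta)$, $$\big|\det D(T_j^\theta)^{-1}(x)-\det D(T_j^\theta)^{-1}(y)\big|\le K\,\big|\det D(T_j^\theta)^{-1}(z)\big|\,\varepsilon;$$ (PE3) $m\big(\Omega\setminus\bigcup_j U_j^\theta\big)=0$; (PE4) for all $u,v\in T_j^\theta(V_j^\theta)$ with $d(u,v)\le\varepsilon_0$, $d\big((T_j^\theta)^{-1}(u),(T_j^\theta)^{-1}(v)\big)\le \sigma^{-1/2}d(u,v)$; (PE5) setting, for $x\in\mathbb R^k$ and $0<\varepsilon\le\delta$, $$G(x,\varepsilon,\delta)=\sum_j\frac{m\Big((T_j^\theta)^{-1}\big[B_\varepsilon(\partial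 T_j^\theta(U_j^\theta))\big]\cap B\big(x,(1-\sigma^{-1/2})\delta\big)\Big)}{m\Big(B\big(x,(1-\sigma^{-1/2})\delta\big)\Big)},\qquad G(\varepsilon,\delta)=\sup_{x}G(x,\varepsilon,\delta),$$ and $\eta(\delta)=\sigma^{-1/2}+2\sup_{\varepsilon\le\delta}\frac{G(\varepsilon,\delta)}{\varepsilon}\,\delta$, one has $\sup_{\delta\le\varepsilon_0}\eta(\delta)<1$.
   Context: Standing setup. Fix an integer $k\ge2$ and reals $L>0$, $\beta>0$. Let $\Phi_0:(-L-\beta,L+\beta)^k\to\mathbb R$ be $C^2$. For $n\ge1$ let $\gamma_n$ be the Lebesgue volume of the unit ball of $\mathbb R^n$. For $\sigma>1$, $Y>0$ put $\eta_0(\sigma,Y)=\sigma^{-1/2}+\frac{4}{\sqrt\sigma-1}\,Y\,\frac{\gamma_{k-1}}{\gamma_k}$ and let $S_k(Y)>1$ be the value of $\sigma$ with $\eta_0(\sigma,Y)=1$. Fix $\sigma>S_k(k+2)$ and constants $C_1,C_2>1$, and assume: $\gamma^{-2}=C_1\sigma$ (this defines $\gamma\in(0,1)$); for all $x\in(-L-\beta,L+\beta)^k$, $(\partial_1\Phi_0(x))^2\ge C_1^{k-1}C_2\sigma^k$ and $(\partial_j\Phi_0(x))^2\le\frac{(C_1-1)(C_2-1)}{k-1}\sigma$ for $2\le j\le k$. Let $\Gamma:\mathbb R^k\to\mathbb R^k$, $\Gamma(x)=(\gamma^{-(j-1)}x_j)_{j=1}^k$; $\Omega=\prod_{j=1}^k[-\gamma^{j-1}L,\gamma^{j-1}L]=\Gamma^{-1}([-L,L]^k)$;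 for $r\in[0,\beta]$, $\Omega_r=\Gamma^{-1}((-L-r,L+r)^k)$. For $\theta\in\mathbb R$, $j\in\mathbb Z$: $U_j^\theta=\{x\in\Omega_0:(2j-1)L<\theta+\Phi_0(\Gamma x)<(2j+1)L\}$ and $\Sigma_j^\theta=\{x\in\Omega:\theta+\Phi_0(\Gamma x)=(2j-1)L\}$. Define $S:\Omega_\beta\to\mathbb R^k$, $S(u)=(u_2/\gamma,\dots,u_k/\gamma,\gamma^{k-1}\Phi_0(\Gamma u))$, and $T_j^\theta(u)=S(u)+(0,\dots,0,\gamma^{k-1}(\theta-2jL))$. The map $T_\theta:\Omega\to\Omega$ is defined almost everywhere by $T_\theta=T_j^\theta$ on $U_j^\theta$ (equivalently $T_\theta(u)=(u_2/\gamma,\dots,u_k/\gamma,\gamma^{k-1}\varphi_\theta(\Gamma u))$ where $\varphi_\theta(x)=\Phi_0(x)+\theta$ reduced modulo $2L$ into $[-L,L]$). Notation: $m$ is Lebesgue measure, $d$ and $\|\cdot\|$ are Euclidean, $B(x,\varepsilon)$ is the open ball, and for $X\subset\mathbb R^k$, $B_\varepsilon(X)=\{x\in\mathbb R^k:d(x,X)<\varepsilon\}$. *)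

(* Defs.v *)
From mathcomp Require Import all_boot all_order all_algebra.
From mathcomp Require Import all_classical all_reals all_analysis.
Set Implicit Arguments. Unset Strict Implicit. Unset Printing Implicit Defensive.
Import Order.TTheory GRing.Theory Num.Theory.
Local Open Scope classical_set_scope.
Local Open Scope ring_scope.

Section Defs.
Variable R : realType.

Definition eucl_dist (k : nat) (x y : 'rV[R]_k) : R :=
  Num.sqrt (\sum_(i < k) (x 0 i - y 0 i) ^+ 2).

Definition eball (k : nat) (x : 'rV[R]_k) (r : R) : set 'rV[R]_k :=
  [set y | eucl_dist x y < r].

(* d(x, X) = inf_{y in X} d(x,y)  (= +oo if X is empty) *)
Definition dist_set (k : nat) (x : 'rV[R]_k) (X : set 'rV[R]_k) : \bar R :=
  ereal_inf [set (eucl_dist x y)%:E | y in X].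

Definition nbhd_set (k : nat) (eps : R) (X : set 'rV[R]_k) : set 'rV[R]_k :=
  [set x | (dist_set x X < eps%:E)%E].

Definition eopen (k : nat) (A : set 'rV[R]_k) : Prop :=
  forall x, A x -> exists2 r : R, 0 < r & eball x r `<=` A.

Definition eclosure (k : nat) (A : set 'rV[R]_k) : set 'rV[R]_k :=
  [set x | forall r : R, 0 < r -> exists2 y, A y & eucl_dist x y < r].

Definition einterior (k : nat) (A : set 'rV[R]_k) : set 'rV[R]_k :=
  [set x | exists2 r : R, 0 < r & eball x r `<=` A].

Definition eboundary (k : nat) (A : set 'rV[R]_k) : set 'rV[R]_k :=
  eclosure A `\` einterior A.

Definition box_vol (k : nat) (a b : 'rV[R]_k) : R :=
  \prod_(i < k) Num.max 0 (b 0 i - a 0 i).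

Definition obox (k : nat) (a b : 'rV[R]_k) : set 'rV[R]_k :=
  [set x | forall i, a 0 i < x 0 i < b 0 i].

Definition leb_outer (k : nat) (A : set 'rV[R]_k) : \bar R :=
  ereal_inf [set s : \bar R | exists a b : nat -> 'rV[R]_k,
     A `<=` \bigcup_n obox (a n) (b n) /\
     s = (\sum_(0 <= n <oo) (box_vol (a n) (b n))%:E)%E].

Definition evec (k : nat) (i : 'I_k) : 'rV[R]_k := delta_mx 0 i.

(* i-th partial derivative of a scalar function (a value only meaningful
   when the partial derivative exists) *)
Definition pd (k : nat) (i : 'I_k) (f : 'rV[R]_k -> R) (x : 'rV[R]_k) : R :=
  derive1 (fun h : R => f (x + h *: evec i)) 0.

Definition has_pd (k : nat) (i : 'I_k) (f : 'rV[R]_k -> R) (x : 'rV[R]_k) : Prop :=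
  derivable (fun h : R => f (x + h *: evec i)) 0 1.

Definition econt_on (k : nat) (V : set 'rV[R]_k) (g : 'rV[R]_k -> R) : Prop :=
  forall x, V x -> forall e : R, 0 < e -> exists2 d : R, 0 < d &
    forall y, V y -> eucl_dist x y < d -> `|g y - g x| < e.

Definition C2_scal (k : nat) (V : set 'rV[R]_k) (f : 'rV[R]_k -> R) : Prop :=
  [/\ econt_on V f,
      forall i, (forall x, V x -> has_pd i f x) /\ econt_on V (pd i f)
    & forall i j, (forall x, V x -> has_pd j (pd i f) x) /\
                  econt_on V (pd j (pd i f))].

Definition coordfun (k : nat) (f : 'rV[R]_k -> 'rV[R]_k) (l : 'I_k) : 'rV[R]_k -> R :=
  fun x => f x 0 l.

Definition C2_on (k : nat) (V : set 'rV[R]_k) (f : 'rV[R]_k -> 'rV[R]_k) : Prop :=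
  forall l, C2_scal V (coordfun f l).

Definition jac (k : nat) (f : 'rV[R]_k -> 'rV[R]_k) (x : 'rV[R]_k) : R :=
  \det (\matrix_(l < k, i < k) pd i (coordfun f l) x).

(* coordinate u_{n+1} (0-based n), 0 if out of range *)
Definition coord (k : nat) (u : 'rV[R]_k) (n : nat) : R :=
  odflt 0 (omap (fun i : 'I_k => u 0 i) (insub n)).

(* Gamma(x) = (gam^{-(j-1)} x_j)_j ; 0-based index i = j-1 *)
Definition Gam (k : nat) (gam : R) (x : 'rV[R]_k) : 'rV[R]_k :=
  \row_(i < k) (gam ^- i * x 0 i).

Definition ocube (k : nat) (a : R) : set 'rV[R]_k :=
  [set x | forall i, - a < x 0 i < a].
Definition ccube (k : nat) (a : R) : set 'rV[R]_k :=
  [set x | forall i, - a <= x 0 i <= a].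

Definition Omega (k : nat) (gam L : R) : set 'rV[R]_k :=
  [set u | ccube L (Gam gam u)].
Definition Omega_r (k : nat) (gam L r : R) : set 'rV[R]_k :=
  [set u | ocube (L + r) (Gam gam u)].

Definition Uj (k : nat) (gam L : R) (Phi0 : 'rV[R]_k -> R) (theta : R) (j : int)
  : set 'rV[R]_k :=
  [set x | Omega_r gam L 0 x /\
     (2 * j - 1)%:~R * L < theta + Phi0 (Gam gam x) < (2 * j + 1)%:~R * L].

Definition Smap (k : nat) (gam : R) (Phi0 : 'rV[R]_k -> R) (u : 'rV[R]_k)
  : 'rV[R]_k :=
  \row_(i < k) (if (i.+1 < k)%N then coord u i.+1 / gam
                else gam ^+ k.-1 * Phi0 (Gam gam u)).

Definition Tj (k : nat) (gam L : R) (Phi0 : 'rV[R]_k -> R) (theta : R) (j : int)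
  (u : 'rV[R]_k) : 'rV[R]_k :=
  Smap gam Phi0 u + \row_(i < k) (if (i.+1 == k)%N
                                   then gam ^+ k.-1 * (theta - 2 * j%:~R * L)
                                   else 0).

(* reduction of t modulo 2L into [-L, L) *)
Definition redmod (L t : R) : R := t - 2 * L * (Num.floor ((t + L) / (2 * L)))%:~R.

Definition Ttheta (k : nat) (gam L : R) (Phi0 : 'rV[R]_k -> R) (theta : R)
  (u : 'rV[R]_k) : 'rV[R]_k :=
  \row_(i < k) (if (i.+1 < k)%N then coord u i.+1 / gam
                else gam ^+ k.-1 * redmod L (Phi0 (Gam gam u) + theta)).

Definition unit_ball_vol (n : nat) : R := fine (leb_outer (eball (0 : 'rV[R]_n) 1)).

Definition eta0 (k : nat) (sigma Y : R) : R :=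
  (Num.sqrt sigma)^-1
  + 4 / (Num.sqrt sigma - 1) * Y * (unit_ball_vol k.-1 / unit_ball_vol k).

Definition Gx (k : nat) (gam L : R) (Phi0 : 'rV[R]_k -> R) (theta sigma : R)
  (eps_m : R) (x : 'rV[R]_k) (eps delta : R) : \bar R :=
  let J := [set j : int | Uj gam L Phi0 theta j !=set0] in
  let rho := (1 - (Num.sqrt sigma)^-1) * delta in
  (\esum_(j in J)
     (leb_outer ([set u | nbhd_set eps_m (Uj gam L Phi0 theta j) u /\
                    nbhd_set eps (eboundary (Tj gam L Phi0 theta j @`
                                     Uj gam L Phi0 theta j))
                             (Tj gam L Phi0 theta j u)] `&` eball x rho)
      * ((fine (leb_outer (eball x rho)))^-1)%:E))%E.

Definition Gsup (k : nat) (gam L : R) (Phi0 : 'rV[R]_k -> R) (theta sigma : R)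
  (eps_m : R) (eps delta : R) : \bar R :=
  ereal_sup [set Gx gam L Phi0 theta sigma eps_m x eps delta | x in setT].

Definition eta_fn (k : nat) (gam L : R) (Phi0 : 'rV[R]_k -> R) (theta sigma : R)
  (eps_m : R) (delta : R) : \bar R :=
  ((Num.sqrt sigma)^-1%:E
   + 2%:E * ereal_sup [set Gsup gam L Phi0 theta sigma eps_m eps delta
                             * (delta / eps)%:E | eps in [set e : R | 0 < e <= delta]%R])%E.

End Defs.

(* Main.v *)
Require Import Defs.
From mathcomp Require Import all_boot all_order all_algebra.
From mathcomp Require Import all_classical all_reals all_analysis.
From mathcomp Require Import ring lra zify.
Import Order.TTheory GRing.Theory Num.Theory.
Import numFieldNormedType.Exports.
Local Open Scope classical_set_scope.
Local Open Scope ring_scope.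

Set Implicit Arguments. Unset Strict Implicit. Unset Printing Implicit Defensive.

(* Write F = Phi0 o Gam, so that the k-th coordinate of T_j is
   gam^(k-1) (F + theta - 2 j L).  The mean value theorem, one coordinate at a
   time, and the two bounds on the derivatives of Phi0 give
   |T_j p - T_j q| >= sqrt sigma |p - q| on the whole enlarged domain.  Hence
   T_j is injective, its inverse contracts by sigma^(-1/2), and it is locally
   onto by the intermediate value theorem in the first coordinate, the other
   ones being determined linearly.  The Jacobian of the inverse branch is
   +-1/(d_1 F), whose distortion is controlled by the bound on the second
   derivatives over a compact box.

   For (PE5), a point of the preimage of the eps-neighbourhood of the boundary
   of T_j(U_j) lies within s = sigma^(-1/2) eps, in its coordinate, of one of the
   faces of Omega, or in the T_j-preimage of an eps-neighbourhood of a level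
   F + theta = (2 l - 1) L.  On a small ball F varies by at most L/4, so a single
   l, hence only j = l and j = l - 1, contributes.  The level slab is met by both
   branches and is counted twice; each of the k face slabs is split between the
   two branches into parts on opposite sides of the level, which are at positive
   distance, so that their outer measures add up to at most that of the slab.
   Each slab meets a ball of radius rho in outer measure at most
   2 s gamma_(k-1) rho^(k-1), which gives the factor k + 2 of eta_0. *)

(** * Covers by countably many open boxes *)

Section BoxCovers.
Variable R : realType.

Lemma box_vol_ge0 (k : nat) (a b : 'rV[R]_k) : 0 <= box_vol a b.
Proof. by apply: prodr_ge0 => i _; rewrite le_max lexx. Qed.

Lemma nneseries_le (u : nat -> \bar R) (c : \bar R) :
  (forall n, 0 <= u n)%E -> (forall n, \sum_(0 <= i < n) u i <= c)%E ->
  (\sum_(0 <= i <oo) u i <= c)%E.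
Proof.
move=> u0 uc; apply: lime_le; first exact: is_cvg_nneseries.
by apply: nearW => n; exact: uc.
Qed.

(** Keeping the shape of the boxes in a predicate [P] lets unrestricted covers and covers by boxes
    with short sides share the same lemmas. *)
Definition box_cover (k : nat) (P : 'rV[R]_k -> 'rV[R]_k -> Prop)
    (A : set 'rV[R]_k) (c : R) :=
  exists a b : nat -> 'rV[R]_k,
    [/\ forall n, P (a n) (b n), A `<=` \bigcup_n obox (a n) (b n)
      & (\sum_(0 <= n <oo) (box_vol (a n) (b n))%:E <= c%:E)%E].

Definition any_box (k : nat) (a b : 'rV[R]_k) := True.

Lemma box_cover_le (k : nat) P (A B : set 'rV[R]_k) c d :
  A `<=` B -> c <= d -> box_cover P B c -> box_cover P A d.
Proof.
move=> AB cd [a [b [Pab Bab le]]]; exists a, b; split=> //.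
- exact: subset_trans Bab.
- by apply: (le_trans le); rewrite lee_fin.
Qed.

Lemma leb_outer_ge0 (k : nat) (A : set 'rV[R]_k) : (0 <= leb_outer A)%E.
Proof.
apply: le_ereal_inf_tmp => _ [a [b [_ ->]]].
by apply: nneseries_ge0 => n _ _; rewrite lee_fin box_vol_ge0.
Qed.

Lemma le_leb_outer (k : nat) (A B : set 'rV[R]_k) :
  A `<=` B -> (leb_outer A <= leb_outer B)%E.
Proof.
move=> AB; apply: ereal_inf_le_tmp => s [a [b [Bab ->]]].
by exists a, b; split=> //; exact: subset_trans Bab.
Qed.

Lemma leb_outer_box_cover (k : nat) (A : set 'rV[R]_k) c :
  (leb_outer A <= c%:E)%E <-> forall e, 0 < e -> box_cover (@any_box k) A (c + e).
Proof.
split=> [Ac e e0|H].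
  have : (leb_outer A < (c + e)%:E)%E.
    by apply: (le_lt_trans Ac); rewrite lte_fin ltrDl.
  move=> /ereal_inf_lt[_ [a [b [Aab ->]]] lt].
  by exists a, b; split=> //; exact: ltW.
apply/lee_addgt0Pr => e e0; have [a [b [_ Aab le]]] := H _ e0.
by rewrite -EFinD; apply: le_trans le; apply: ereal_inf_lbound; exists a, b.
Qed.

Lemma box_cover_bigcup (k : nat) P (A : nat -> set 'rV[R]_k) (c : nat -> R) d :
  (forall n, box_cover P (A n) (c n)) ->
  (\sum_(0 <= n <oo) (c n)%:E <= d%:E)%E ->
  box_cover P (\bigcup_n A n) d.
Proof.
move=> /choice[a] /choice[b] H cd.
have /card_esym/ppcard_eqP[f] := card_nat2.
pose vol (p : nat * nat) := (box_vol (a p.1 p.2) (b p.1 p.2))%:E.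
have vol0 p : (0 <= vol p)%E by rewrite lee_fin box_vol_ge0.
exists (fun n => a (f n).1 (f n).2), (fun n => b (f n).1 (f n).2); split.
- by move=> n; have [+ _ _] := H (f n).1; exact.
- move=> t [i _ Ait]; have [_ /(_ _ Ait)[j _ tij] _] := H i.
  by exists (f^-1%FUN (i, j)) => //=; rewrite invK ?inE.
(* All terms are nonnegative, so the series along the enumeration [f] of pairs is an unordered sum,
   which is then split into an iterated series. *)
apply: (@le_trans _ _ (\esum_(i in setT) vol i)%E).
  rewrite -(esum_pred_image vol f xpredT) ?[fun=> _]set_true//.
  by rewrite image_eq.
rewrite (_ : esum _ _ = \sum_(0 <= i <oo) \sum_(0 <= j <oo) vol (i, j))%E; last first.
  pose J : nat -> set (nat * nat) := fun i => [set (i, j) | j in setT].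
  rewrite (_ : setT = \bigcup_k J k); last first.
    by rewrite predeqE => -[x y]; split => // _; exists x => //; exists y.
  rewrite esum_bigcupT /=; last 2 first.
    - apply/trivIsetP => i j _ _ ij.
      rewrite predeqE => -[n m] /=; split => //= -[] [_] _ [<-{n} _].
      by move=> [m' _] [] /esym/eqP; rewrite (negbTE ij).
    - by [].
  rewrite -(image_id [set: nat]) -fun_true esum_pred_image//; last first.
    by move=> n _; exact: esum_ge0.
  apply: eq_eseriesr => /= j _.
  rewrite -(esum_pred_image vol (pair j) predT)//=; last first.
    by move=> ? ? _ _; exact: (@can_inj _ _ _ snd).
  by congr esum; rewrite predeqE => -[x y]; split; move=> [i _ <-]; exists i.
apply: le_trans cd; apply: lee_nneseries => [n _ _|n _].
  by apply: nneseries_ge0 => m _ _; exact: vol0.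
by have [_ _] := H n.
Qed.

Lemma leb_outer_bigcup_null (k : nat) (A : nat -> set 'rV[R]_k) :
  (forall n, leb_outer (A n) <= 0)%E -> (leb_outer (\bigcup_n A n) <= 0)%E.
Proof.
move=> A0; apply/leb_outer_box_cover => e e0; rewrite add0r.
apply: (@box_cover_bigcup _ _ _ (fun n => e / (2 ^ n.+1)%:R)).
  move=> n; have /leb_outer_box_cover := A0 n => /(_ (e / (2 ^ n.+1)%:R)).
  by rewrite add0r; apply; rewrite divr_gt0// ltr0n expn_gt0.
have := @epsilon_trick R (fun=> 0%E) e xpredT (fun=> lexx _) (ltW e0).
rewrite [X in (_ <= X + _)%E]eseries0// add0e; apply: le_trans.
by rewrite le_eqVlt; apply/orP; left; apply/eqP/eq_eseriesr => i _; rewrite add0e.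
Qed.

(** Finite covers suffice: the tail is filled with the degenerate box at the origin, which has
    volume zero because [0 < k] (an empty product would be 1). *)
Lemma box_cover_null_tail (k : nat) P (A : set 'rV[R]_k) (N : nat)
    (a b : nat -> 'rV[R]_k) c :
  P (0 : 'rV[R]_k) (0 : 'rV[R]_k) -> (0 < k)%N ->
  (forall t, (t < N)%N -> P (a t) (b t)) ->
  (forall x, A x -> exists2 t, (t < N)%N & obox (a t) (b t) x) ->
  \sum_(t < N) box_vol (a t) (b t) <= c ->
  box_cover P A c.
Proof.
move=> P0 k0 Pab Aab le.
exists (fun t => if (t < N)%N then a t else 0), (fun t => if (t < N)%N then b t else 0).
have v0 : box_vol (0 : 'rV[R]_k) 0 = 0.
  rewrite /box_vol (bigD1 (Ordinal k0))//= mxE subrr maxxx mul0r//.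
split.
- by move=> n; case: ifPn => // nN; exact: Pab.
- by move=> x /Aab[t tN xt]; exists t => //=; rewrite tN.
apply: nneseries_le => [n|n]; first by rewrite lee_fin box_vol_ge0.
rewrite sumEFin lee_fin; apply: le_trans le.
rewrite -(big_mkord xpredT (fun t => box_vol (a t) (b t))).
rewrite [leLHS](eq_bigr (fun i => if (i < N)%N then box_vol (a i) (b i) else 0)); last first.
  by move=> i _; case: ifPn => _; rewrite ?v0.
rewrite -big_mkcond/=.
have [nN|Nn] := leqP n N.
  rewrite (big_cat_nat _ nN)//= -[leLHS]addr0 lerD//.
    rewrite [leLHS]big_mkcond/=.
    by apply: ler_sum_nat => i _; case: ifPn => // _; exact: box_vol_ge0.
  by apply: sumr_ge0 => i _; exact: box_vol_ge0.
rewrite (big_cat_nat _ (ltnW Nn))//= [X in _ + X]big_nat_cond [X in _ + X]big1 ?addr0.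
  by rewrite [leLHS]big_mkcond/=; apply: ler_sum_nat => i /andP[_ ->].
by move=> i /andP[/andP[Ni _] iN]; move: (leq_ltn_trans Ni iN); rewrite ltnn.
Qed.

End BoxCovers.

(** * Refining covers to boxes with short sides *)

Section FineCovers.
Variable R : realType.

(** Only the coordinates of index below [m] are constrained, so that boxes can be cut in one
    direction after another. *)
Definition fine_box (k : nat) (h : R) (m : nat) (a b : 'rV[R]_k) :=
  forall i : 'I_k, (i < m)%N -> b 0 i - a 0 i < h.

Definition set_coord (k : nat) (u : 'rV[R]_k) (i : 'I_k) (x : R) : 'rV[R]_k :=
  \row_j (if j == i then x else u 0 j).

Lemma set_coord_same (k : nat) (u : 'rV[R]_k) i x : set_coord u i x 0 i = x.
Proof. by rewrite mxE eqxx. Qed.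

Lemma set_coord_other (k : nat) (u : 'rV[R]_k) i x j :
  j != i -> set_coord u i x 0 j = u 0 j.
Proof. by rewrite mxE => /negbTE ->. Qed.

Lemma box_vol_set_coord (k : nat) (a b : 'rV[R]_k) i x y : x <= y ->
  box_vol (set_coord a i x) (set_coord b i y) =
  (y - x) * \prod_(j < k | j != i) Num.max 0 (b 0 j - a 0 j).
Proof.
move=> xy; rewrite /box_vol (bigD1 i)//= !set_coord_same; congr (_ * _).
  by rewrite max_r// subr_ge0.
by apply: eq_bigr => j ji; rewrite !set_coord_other.
Qed.

(** Direction [m] is cut into equal slices; since boxes are open, each slice is widened by a small
    [eta] to recover the points on the cuts, at a total cost of at most [e]. *)
Lemma subdivide_box (k : nat) (h : R) (m : nat) (a b : 'rV[R]_k) (e : R) :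
  0 < h -> 0 < e -> (m < k)%N -> fine_box h m a b ->
  box_cover (fine_box h m.+1) (obox a b) (box_vol a b + e).
Proof.
move=> h0 e0 mk ab; pose i := Ordinal mk.
have P0 : fine_box h m.+1 (0 : 'rV[R]_k) (0 : 'rV[R]_k).
  by move=> j _; rewrite mxE subrr.
have k0 : (0 < k)%N by apply: (leq_ltn_trans _ mk).
have [l0|l0] := leP (b 0 i - a 0 i) 0.
  apply: (@box_cover_null_tail _ _ _ _ 0 (fun=> 0) (fun=> 0)) => //.
    by move=> x /(_ i) xi; lra.
  by rewrite big_ord0 addr_ge0 ?box_vol_ge0// ltW.
set l := b 0 i - a 0 i in l0.
pose r := \prod_(j < k | j != i) Num.max 0 (b 0 j - a 0 j).
have r0 : 0 <= r by apply: prodr_ge0 => j _; rewrite le_max lexx.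
have volE : box_vol a b = l * r.
  by rewrite /box_vol (bigD1 i)//= max_r// ltW.
(* This number of slices makes each of them thinner than [h / 2], leaving [h / 2] for the
   overlap. *)
pose N := (Num.truncn (2 * l / h)).+1.
have N0 : 0 < N%:R :> R by rewrite ltr0n.
have lN : l / N%:R < h / 2.
  have : 2 * l / h < N%:R by exact: truncnS_gt.
  rewrite !ltr_pdivrMr// => H; lra.
pose eta := Num.min (h / 2) (e / (N%:R * (r + 1))).
have r1 : 0 < r + 1 by lra.
have eta0 : 0 < eta by rewrite lt_min !divr_gt0// mulr_gt0.
pose s t := a 0 i + t%:R * (l / N%:R).
apply: (@box_cover_null_tail _ _ _ _ N
  (fun t => set_coord a i (s t)) (fun t => set_coord b i (s t.+1 + eta))) => //.
- move=> t tN j; rewrite ltnS leq_eqVlt => /predU1P[ji|jm].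
    have -> : j = i by exact/val_inj.
    rewrite !set_coord_same /s -natr1.
    have : eta <= h / 2 by rewrite ge_min lexx.
    move: lN; set q := l / N%:R; move=> *; lra.
  rewrite !set_coord_other; [exact: ab| |];
    by apply/eqP => ji; move: jm; rewrite ji ltnn.
- move=> x xab; have := xab i => /andP[axi xbi].
  pose t := Num.truncn ((x 0 i - a 0 i) / (l / N%:R)).
  have q0 : 0 < l / N%:R by rewrite divr_gt0.
  have ht0 : 0 <= (x 0 i - a 0 i) / (l / N%:R) by rewrite divr_ge0// ltW// subr_gt0.
  have /andP[t1 t2] := truncn_itv ht0.
  have sN : s N = b 0 i by rewrite /s /l; field; rewrite gt_eqF.
  rewrite -/t in t1 t2.
  have t1' : s t <= x 0 i by move: t1; rewrite ler_pdivlMr// /s; lra.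
  have t2' : x 0 i < s t.+1 by move: t2; rewrite ltr_pdivrMr// /s; lra.
  have tN : (t < N)%N.
    rewrite ltnNge; apply/negP => Nt.
    have : s N <= s t by rewrite /s lerD2l ler_pM2r// ler_nat.
    by rewrite sN; lra.
  (* A point on the cut [s t] is missed by slice [t] but lies in the widened slice before it, which
     exists because [x 0 i] exceeds [a 0 i = s 0]. *)
  have [t0|t0] := eqVneq (x 0 i) (s t); last first.
    exists t => // j; have [->|ji] := eqVneq j i.
      by rewrite !set_coord_same; apply/andP; split; lra.
    by rewrite !set_coord_other.
  case: t => [|t] in t1 t2 t1' t2' tN t0 *.
    by move: t0; rewrite /s mul0r; lra.
  exists t => [|j]; first exact: ltn_trans tN.
  have [->|ji] := eqVneq j i.
    rewrite !set_coord_same; apply/andP; split; last by lra.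
    rewrite t0 /s -natr1; move: q0; set q := l / N%:R; lra.
  by rewrite !set_coord_other.
rewrite (eq_bigr (fun=> (l / N%:R + eta) * r)); last first.
  move=> t _; rewrite box_vol_set_coord -/r.
    by congr (_ * _); rewrite /s -natr1; ring.
  have q0 : 0 < l / N%:R by rewrite divr_gt0.
  by rewrite /s -natr1; move: q0; set q := l / N%:R; lra.
rewrite sumr_const card_ord -[leLHS]mulr_natr volE.
have : eta <= e / (N%:R * (r + 1)) by rewrite ge_min lexx orbT.
rewrite ler_pdivlMr ?mulr_gt0// => He.
have -> : (l / N%:R + eta) * r * N%:R = l * r + eta * (N%:R * r).
  by field; rewrite gt_eqF.
rewrite lerD2l; apply: le_trans He; rewrite ler_pM2l// ler_pM2l//; lra.
Qed.

Lemma fine_cover_step (k : nat) (h : R) (m : nat) (A : set 'rV[R]_k) (c e : R) :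
  0 < h -> 0 < e -> (m < k)%N ->
  box_cover (fine_box h m) A c -> box_cover (fine_box h m.+1) A (c + e).
Proof.
move=> h0 e0 mk [a [b [ab Aab le]]].
apply: (@box_cover_le _ _ _ _ _ _ _ Aab (lexx _)).
apply: (@box_cover_bigcup _ _ _ _
  (fun n => box_vol (a n) (b n) + e / (2 ^ n.+1)%:R)).
  move=> n; apply: subdivide_box => //; first by rewrite divr_gt0// ltr0n expn_gt0.
have := @epsilon_trick R (fun n => (box_vol (a n) (b n))%:E) e xpredT
  (fun n => _) (ltW e0).
move=> /(_ (fun n => _)); rewrite EFinD.
move=> H; apply: le_trans; first apply: H => n; first by rewrite lee_fin box_vol_ge0.
by rewrite leeD2r.
Qed.

Lemma leb_outer_fine_cover (k : nat) (h : R) (A : set 'rV[R]_k) (c e : R) :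
  0 < h -> 0 < e -> (leb_outer A <= c%:E)%E ->
  box_cover (fine_box h k) A (c + e).
Proof.
move=> h0 e0 Ac.
suff H m : (m <= k)%N -> forall e, 0 < e -> box_cover (fine_box h m) A (c + e).
  exact: H.
elim: m => [_ {e0}e e0|m IH mk {e0}e e0].
  have /leb_outer_box_cover/(_ _ e0)[a [b [_ Aab le]]] := Ac.
  by exists a, b; split.
rewrite (_ : c + e = c + e / 2 + e / 2); last by lra.
by apply: fine_cover_step; rewrite ?divr_gt0//; apply: IH; rewrite ?divr_gt0// ltnW.
Qed.

End FineCovers.

(** * Subadditivity, slabs, separated sets and scaling for the outer measure *)

Section OuterMeasure.
Variable R : realType.

Lemma leb_outer_sigma_subadditive (k : nat) (A : nat -> set 'rV[R]_k) :
  (leb_outer (\bigcup_n A n) <= \sum_(0 <= n <oo) leb_outer (A n))%E.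
Proof.
have ge0 n : (0 <= leb_outer (A n))%E by exact: leb_outer_ge0.
case E : (\sum_(0 <= n <oo) leb_outer (A n))%E => [d| |]; last 2 first.
- by rewrite leey.
- have : (0 <= \sum_(0 <= n <oo) leb_outer (A n))%E by exact: nneseries_ge0.
  by rewrite E.
have fin n : leb_outer (A n) \is a fin_num.
  rewrite ge0_fin_numE// ltey; apply/eqP => Aoo.
  have := @eseries_pinfty R (fun n => leb_outer (A n)) xpredT n _ isT Aoo.
  rewrite E => H; suff : d%:E = +oo%E by [].
  by apply: H => m _; rewrite -ltNye (lt_le_trans _ (ge0 m)).
apply/leb_outer_box_cover => e e0.
apply: (@box_cover_bigcup _ _ _ _
  (fun n => fine (leb_outer (A n)) + e / (2 ^ n.+1)%:R)).
  move=> n; have [+ _] := @leb_outer_box_cover R k (A n) (fine (leb_outer (A n))).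
  by apply; rewrite ?fineK// divr_gt0// ltr0n expn_gt0.
rewrite EFinD -E; under eq_eseriesr do rewrite EFinD fineK//.
exact: epsilon_trick (ltW e0).
Qed.

Lemma leb_outer_set0 (k : nat) : (0 < k)%N -> leb_outer (set0 : set 'rV[R]_k) = 0%E.
Proof.
move=> k0; apply/eqP; rewrite eq_le leb_outer_ge0 andbT.
apply/leb_outer_box_cover => e e0.
apply: (@box_cover_null_tail _ _ _ _ 0 (fun=> 0) (fun=> 0)) => //.
by rewrite big_ord0 add0r ltW.
Qed.

Lemma leb_outer_setU (k : nat) (A B : set 'rV[R]_k) : (0 < k)%N ->
  (leb_outer (A `|` B) <= leb_outer A + leb_outer B)%E.
Proof.
move=> k0; pose F n := if n is 0%N then A else if n is 1%N then B else set0.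
have -> : A `|` B = \bigcup_n F n.
  rewrite predeqE => x; split.
    by move=> [Ax|Bx]; [exists 0%N|exists 1%N].
  by move=> [[|[|n]] _]; [left|right|].
apply: (le_trans (leb_outer_sigma_subadditive F)).
apply: nneseries_le => [n|n]; first exact: leb_outer_ge0.
have F0 n' : leb_outer (F n'.+2) = 0%E by rewrite leb_outer_set0.
case: n => [|[|n]].
- by rewrite big_nil adde_ge0 ?leb_outer_ge0.
- by rewrite big_nat1 leeDl ?leb_outer_ge0.
- rewrite big_nat_recl// big_nat_recl//= big1 ?adde0// => i _; exact: F0.
Qed.

Lemma leb_outer_bigU (k : nat) (I : eqType) (s : seq I) (A : I -> set 'rV[R]_k) :
  (0 < k)%N ->
  (leb_outer [set u | exists2 i, i \in s & A i u] <=
     \sum_(i <- s) leb_outer (A i))%E.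
Proof.
move=> k0; elim: s => [|i s IH].
  rewrite big_nil (_ : [set _ | _] = set0) ?leb_outer_set0// predeqE => u.
  by split=> // -[].
rewrite big_cons; apply: le_trans (leeD (lexx _) IH).
apply: le_trans (leb_outer_setU _ _ k0); apply: le_leb_outer => u [j].
by rewrite inE => /predU1P[->|js] Aj; [left|right; exists j].
Qed.

Lemma leb_outer_obox (k : nat) (a b : 'rV[R]_k) : (0 < k)%N ->
  (leb_outer (obox a b) <= (box_vol a b)%:E)%E.
Proof.
move=> k0; apply/leb_outer_box_cover => e e0.
apply: (@box_cover_null_tail _ _ _ _ 1 (fun=> a) (fun=> b)) => //.
  by move=> x ?; exists 0%N.
by rewrite big_ord1 lerDl ltW.
Qed.

(** A right inverse of [col' i], used in particular to erect a box over a box of the projection. *)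
Definition insert_coord (n : nat) (i : 'I_n.+1) (x : R) (a : 'rV[R]_n) : 'rV[R]_n.+1 :=
  \row_j (if unlift i j is Some j' then a 0 j' else x).

Lemma box_vol_insert (n : nat) (i : 'I_n.+1) x y (a b : 'rV[R]_n) : x <= y ->
  box_vol (insert_coord i x a) (insert_coord i y b) = (y - x) * box_vol a b.
Proof.
move=> xy; rewrite /box_vol (bigD1_ord i)//= !mxE unlift_none; congr (_ * _).
  by rewrite max_r// subr_ge0.
by apply: eq_bigr => j _; rewrite !mxE liftK.
Qed.

(* Over a box of side less than [h] the set lies in an interval of length
   [t + C * h] in direction [i]; fine covers of the projection make [h] vanish. *)
Lemma leb_outer_slab (n : nat) (i : 'I_n.+1) (E : set 'rV[R]_n.+1)
    (P : set 'rV[R]_n) (t C c : R) :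
  0 <= t -> 0 <= C -> (leb_outer P <= c%:E)%E ->
  (forall u, E u -> P (col' i u)) ->
  (forall u v h, E u -> E v ->
     (forall j, j != i -> `|u 0 j - v 0 j| <= h) -> u 0 i - v 0 i <= t + C * h) ->
  (leb_outer E <= (t * c)%:E)%E.
Proof.
move=> t0 C0 Pc EP Eosc; apply/leb_outer_box_cover => e e0.
have c0 : 0 <= c by rewrite -lee_fin; apply: le_trans Pc; exact: leb_outer_ge0.
(* The volume of the cover built below exceeds [t * c] by at most [h * (t + (C + 1) * (c + h))],
   which is at most [h * D] as [h <= 1]. *)
pose D := t + (C + 1) * (c + 1).
have D0 : 0 < D by rewrite /D ltr_wpDl// mulr_gt0//; lra.
pose h := Num.min 1 (e / D).
have h0 : 0 < h by rewrite lt_min ltr01 divr_gt0.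
have h1 : h <= 1 by rewrite ge_min lexx.
have hD : h * D <= e by rewrite -ler_pdivlMr// ge_min lexx orbT.
have [a [b [ab Pab le]]] := leb_outer_fine_cover h0 h0 Pc.
pose Q m := [set u | E u /\ obox (a m) (b m) (col' i u)].
(* The part of [E] over box [m] starts at this height. If that part is empty the infimum is a
   default value, which is harmless because the erected box has height [w] in every case. *)
pose lo m := inf [set u 0 i | u in Q m].
pose w := t + C * h + h.
have Ch : 0 <= C * h by apply: mulr_ge0 => //; exact: ltW.
exists (fun m => insert_coord i (lo m - h / 2) (a m)),
       (fun m => insert_coord i (lo m + t + C * h + h / 2) (b m)); split=> //.
- move=> u Eu; have [m _ um] := Pab _ (EP _ Eu); exists m => // j.
  have osc v : Q m v -> u 0 i - v 0 i <= t + C * h.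
    move=> [Ev vm]; apply: Eosc => // j' ji.
    rewrite eq_sym in ji; have [j'' jE _] := unlift_some ji.
    have := um j''; have := vm j''; rewrite !mxE -jE => /andP[? ?] /andP[? ?].
    have := ab m j'' (ltn_ord _) => ?.
    by rewrite ler_norml; apply/andP; split; lra.
  rewrite !mxE; case: unliftP => [j' ->|->].
    by have := um j'; rewrite !mxE.
  have lb : lbound [set v 0 i | v in Q m] (u 0 i - (t + C * h)).
    by move=> _ [v Qv <-]; have := osc v Qv; lra.
  have ne : [set v 0 i | v in Q m] !=set0 by exists (u 0 i), u.
  have l1 : lo m <= u 0 i by apply: ge_inf; [exists (u 0 i - (t + C * h))|exists u].
  have l2 : u 0 i - (t + C * h) <= lo m by apply: lb_le_inf.
  by apply/andP; split; lra.
under eq_eseriesr => m _.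
  rewrite box_vol_insert; last by lra.
  rewrite (_ : _ - _ = w); last by rewrite /w; lra.
  rewrite EFinM; over.
rewrite nneseriesZl; last by move=> m _; rewrite lee_fin box_vol_ge0.
apply: (@le_trans _ _ (w%:E * (c + h)%:E)%E).
  by apply: lee_wpmul2l => //; rewrite lee_fin /w; lra.
rewrite -EFinM lee_fin.
have -> : w * (c + h) = t * c + h * (t + (C + 1) * (c + h)) by rewrite /w; ring.
rewrite lerD2l; apply: le_trans hD; rewrite ler_pM2l// /D lerD2l ler_pM2l//; lra.
Qed.

(* No box of a cover with sides less than [h] meets both sets. *)
Lemma leb_outer_separated (k : nat) (E1 E2 : set 'rV[R]_k) (h c : R) :
  (0 < k)%N -> 0 < h ->
  (forall u v, E1 u -> E2 v -> exists i, h <= `|u 0 i - v 0 i|) ->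
  (leb_outer (E1 `|` E2) <= c%:E)%E ->
  (leb_outer E1 + leb_outer E2 <= c%:E)%E.
Proof.
move=> k0 h0 sep Ec; apply/lee_addgt0Pr => e e0; rewrite -EFinD.
have [a [b [ab Eab le]]] := leb_outer_fine_cover h0 e0 Ec.
(* Boxes meeting [E1] are kept for [E1] and all others for [E2]; [sel] replaces the discarded ones
   by a null box, so the two volume series add up to the original one. *)
pose meets m := `[< (obox (a m) (b m) `&` E1) !=set0 >].
pose sel (p : nat -> bool) (x : nat -> 'rV[R]_k) m := if p m then x m else 0.
have v0 : box_vol (0 : 'rV[R]_k) 0 = 0.
  by rewrite /box_vol (bigD1 (Ordinal k0))//= mxE subrr maxxx mul0r.
have lesel (p : nat -> bool) (E : set 'rV[R]_k) :
    (forall x, E x -> exists2 m, p m & obox (a m) (b m) x) ->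
    (leb_outer E <= \sum_(0 <= m <oo) (box_vol (sel p a m) (sel p b m))%:E)%E.
  move=> H; apply: ereal_inf_lbound; exists (sel p a), (sel p b); split=> //.
  by move=> x /H[m pm xm]; exists m => //; rewrite /sel pm.
apply: le_trans le.
apply: le_trans (leeD (lesel meets E1 _) (lesel (fun m => ~~ meets m) E2 _)) _.
- move=> x Ex; have [m _ xm] := Eab x (or_introl Ex).
  by exists m => //; apply/asboolP; exists x.
- move=> x Ex; have [m _ xm] := Eab x (or_intror Ex).
  exists m => //; apply/asboolPn => -[y [ym Ey]].
  have [i] := sep _ _ Ey Ex; rewrite leNgt => /negP; apply.
  have := ab m i (ltn_ord _); have /andP[? ?] := ym i; have /andP[? ?] := xm i => ?.
  by rewrite ltr_norml; apply/andP; split; lra.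
rewrite -nneseriesD; try by move=> m *; rewrite lee_fin box_vol_ge0.
apply: lee_nneseries => [m _|m _]; first by rewrite adde_ge0// lee_fin box_vol_ge0.
by rewrite /sel -EFinD lee_fin; case: (meets m); rewrite /= v0 ?addr0 ?add0r.
Qed.

Lemma leb_outer_affine (k : nat) (A B : set 'rV[R]_k) (x : 'rV[R]_k) (l c : R) :
  0 < l -> (leb_outer B <= c%:E)%E ->
  (forall u, A u -> exists2 v, B v & u = x + l *: v) ->
  (leb_outer A <= (l ^+ k * c)%:E)%E.
Proof.
move=> l0 Bc AB; apply/leb_outer_box_cover => e e0.
have lk0 : 0 < l ^+ k by rewrite exprn_gt0.
have [+ _] := @leb_outer_box_cover R k B c.
move=> /(_ Bc (e / l ^+ k) (divr_gt0 e0 lk0))[a [b [_ Bab le]]].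
exists (fun n => x + l *: a n), (fun n => x + l *: b n); split=> //.
- move=> u /AB[v /Bab[n _ vn] ->]; exists n => // i.
  by have := vn i; rewrite !mxE !ltrD2l !ltr_pM2l.
have vE n : box_vol (x + l *: a n) (x + l *: b n) = l ^+ k * box_vol (a n) (b n).
  rewrite /box_vol -[k in l ^+ k]card_ord -prodr_const -big_split/=.
  apply: eq_bigr => i _; rewrite !mxE maxr_pMr ?(ltW l0)// mulr0; congr Num.max; ring.
under eq_eseriesr do rewrite vE EFinM.
rewrite nneseriesZl; last by move=> m _; rewrite lee_fin box_vol_ge0.
have -> : (l ^+ k * c + e)%:E = ((l ^+ k)%:E * (c + e / l ^+ k)%:E)%E.
  by rewrite -EFinM; congr EFin; field; rewrite gt_eqF.
by apply: lee_wpmul2l => //; rewrite lee_fin ltW.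
Qed.

End OuterMeasure.

(** * Euclidean distance and the volume of balls *)

Section Euclid.
Variable R : realType.

Lemma sum_sqr_ge0 (I : Type) (s : seq I) (P : pred I) (x : I -> R) :
  0 <= \sum_(i <- s | P i) x i ^+ 2.
Proof. by apply: sumr_ge0 => i _; exact: sqr_ge0. Qed.

(** The discriminant argument: a nonnegative quadratic in [t] is evaluated at its minimum
    [c / a]. *)
Lemma cauchy_schwarz_sum (I : finType) (P : pred I) (x y : I -> R) :
  (\sum_(i | P i) x i * y i) ^+ 2 <=
  (\sum_(i | P i) x i ^+ 2) * (\sum_(i | P i) y i ^+ 2).
Proof.
set a := \sum_(i | P i) x i ^+ 2; set b := \sum_(i | P i) y i ^+ 2.
set c := \sum_(i | P i) x i * y i.
have a0 : 0 <= a by exact: sum_sqr_ge0.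
have b0 : 0 <= b by exact: sum_sqr_ge0.
have quad t : 0 <= t ^+ 2 * a - 2 * t * c + b.
  have -> : t ^+ 2 * a - 2 * t * c + b = \sum_(i | P i) (t * x i - y i) ^+ 2.
    rewrite /a /b /c !mulr_sumr -sumrB -big_split/=.
    by apply: eq_bigr => i _; ring.
  exact: sum_sqr_ge0.
have [a00|an0] := eqVneq a 0.
  have c0 : c = 0.
    rewrite /c big1// => i Pi; move/eqP: a00.
    rewrite psumr_eq0; last by move=> j _; exact: sqr_ge0.
    by move=> /allP/(_ i (mem_index_enum i)); rewrite Pi/= sqrf_eq0 => /eqP ->; rewrite mul0r.
  by rewrite c0 expr0n/= mulr_ge0.
have ap : 0 < a by rewrite lt_neqAle eq_sym an0.
have := quad (c / a); have -> : (c / a) ^+ 2 * a - 2 * (c / a) * c + b = b - c ^+ 2 / a.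
  by field.
by rewrite subr_ge0 ler_pdivrMr// mulrC.
Qed.

Variable k : nat.
Implicit Types x y z : 'rV[R]_k.

Lemma eucl_dist_ge0 x y : 0 <= eucl_dist x y.
Proof. exact: sqrtr_ge0. Qed.

Lemma eucl_distxx x : eucl_dist x x = 0.
Proof. by rewrite /eucl_dist big1 ?sqrtr0// => i _; rewrite subrr expr0n. Qed.

Lemma eucl_distC x y : eucl_dist x y = eucl_dist y x.
Proof.
by rewrite /eucl_dist; congr Num.sqrt; apply: eq_bigr => i _; rewrite -sqrrN opprB.
Qed.

Lemma sqr_eucl_dist x y : eucl_dist x y ^+ 2 = \sum_(i < k) (x 0 i - y 0 i) ^+ 2.
Proof. by rewrite sqr_sqrtr// sum_sqr_ge0. Qed.

Lemma coord_le_dist x y i : `|x 0 i - y 0 i| <= eucl_dist x y.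
Proof.
rewrite -sqrtr_sqr ler_sqrt ?sum_sqr_ge0// (bigD1 i)//= lerDl.
exact: sum_sqr_ge0.
Qed.

Lemma eucl_dist_le_coord x y h : 0 <= h ->
  (forall i, `|x 0 i - y 0 i| <= h) -> eucl_dist x y <= k%:R * h.
Proof.
move=> h0 H; rewrite -(ger0_norm (mulr_ge0 (ler0n _ k) h0)) -sqrtr_sqr.
rewrite ler_sqrt ?sqr_ge0// (@le_trans _ _ (\sum_(i < k) h ^+ 2))//.
  apply: ler_sum => i _; rewrite -[leLHS]real_normK ?num_real//.
  by rewrite lerXn2r ?nnegrE ?normr_ge0.
rewrite sumr_const card_ord -[leLHS]mulr_natl exprMn ler_wpM2r ?sqr_ge0//.
by rewrite -natrX ler_nat; nia.
Qed.

Lemma eucl_dist_triangle y x z : eucl_dist x z <= eucl_dist x y + eucl_dist y z.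
Proof.
rewrite -(ler_pXn2r (n := 2))// ?nnegrE ?addr_ge0 ?eucl_dist_ge0//.
rewrite sqrrD !sqr_eucl_dist.
set a := \sum_(i < k) (x 0 i - y 0 i) ^+ 2; set b := \sum_(i < k) (y 0 i - z 0 i) ^+ 2.
pose c := \sum_(i < k) (x 0 i - y 0 i) * (y 0 i - z 0 i).
have -> : \sum_(i < k) (x 0 i - z 0 i) ^+ 2 = a + c *+ 2 + b.
  rewrite -mulr_natl /a /b /c mulr_sumr -!big_split/=.
  by apply: eq_bigr => i _; ring.
rewrite lerD2r lerD2l ler_wMn2r//.
apply: (le_trans (ler_norm _)); rewrite -sqrtr_sqr /eucl_dist -sqrtrM ?sum_sqr_ge0//.
by rewrite ler_sqrt ?mulr_ge0 ?sum_sqr_ge0// cauchy_schwarz_sum.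
Qed.

Lemma nbhd_setP eps (X : set 'rV[R]_k) x :
  nbhd_set eps X x <-> exists2 y, X y & eucl_dist x y < eps.
Proof.
split=> [/ereal_inf_lt[_ [y Xy <-]]|[y Xy xy]]; first by rewrite lte_fin; exists y.
rewrite /nbhd_set/=; apply: (@le_lt_trans _ _ (eucl_dist x y)%:E); last by rewrite lte_fin.
by apply: ereal_inf_lbound; exists y.
Qed.

Lemma eopen_nbhd_set eps (X : set 'rV[R]_k) : eopen (nbhd_set eps X).
Proof.
move=> x /nbhd_setP[y Xy xy]; exists (eps - eucl_dist x y); first by rewrite subr_gt0.
move=> z xz; apply/nbhd_setP; exists y => //.
by have := eucl_dist_triangle x z y; rewrite (eucl_distC z x); move: xz; rewrite /eball/=; lra.
Qed.

Lemma eclosure_nbhd_set eps (X : set 'rV[R]_k) : 0 < eps -> eclosure X `<=` nbhd_set eps X.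
Proof. by move=> e0 x /(_ _ e0)[y Xy xy]; apply/nbhd_setP; exists y. Qed.

Lemma leb_outer_eball_fin x r : (0 < k)%N ->
  leb_outer (eball x r) \is a fin_num.
Proof.
move=> k0; rewrite ge0_fin_numE ?leb_outer_ge0//.
apply: le_lt_trans (_ : leb_outer (obox (x - const_mx r) (x + const_mx r)) < _)%E.
  apply: le_leb_outer => y xy i; have := coord_le_dist x y i.
  by rewrite !mxE ler_norml => /andP[? ?]; move: xy; rewrite /eball/= => ?; apply/andP; split; lra.
by apply: (le_lt_trans (leb_outer_obox _ _ k0)); rewrite ltey.
Qed.

(** Both inequalities are instances of [leb_outer_affine], for the dilation taking the unit ball to
    the ball and for its inverse. *)
Lemma leb_outer_eball x r : (0 < k)%N -> 0 < r ->
  leb_outer (eball x r) = (r ^+ k * unit_ball_vol R k)%:E.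
Proof.
move=> k0 r0; apply/eqP; rewrite eq_le; apply/andP; split.
  apply: (@leb_outer_affine _ _ _ (eball 0 1) x) => //.
    by rewrite fineK// leb_outer_eball_fin.
  move=> u xu; exists (r^-1 *: (u - x)); last first.
    by rewrite scalerA divff ?gt_eqF// scale1r addrC subrK.
  rewrite /eball/= -(ltr_pM2l r0) mulr1.
  rewrite (_ : r * _ = eucl_dist x u)//.
  rewrite /eucl_dist -{1}(ger0_norm (ltW r0)) -sqrtr_sqr -sqrtrM ?sqr_ge0// mulr_sumr.
  congr Num.sqrt; apply: eq_bigr => i _; rewrite !mxE; field; exact: lt0r_neq0.
have [e E] : exists e, leb_outer (eball x r) = e%:E.
  by exists (fine (leb_outer (eball x r))); rewrite fineK ?leb_outer_eball_fin.
rewrite E lee_fin mulrC -ler_pdivlMr ?exprn_gt0// -lee_fin fineK ?leb_outer_eball_fin//.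
rewrite mulrC -exprVn.
apply: (@leb_outer_affine _ _ _ (eball x r) (- r^-1 *: x)).
- by rewrite invr_gt0.
- by rewrite E.
move=> u u1; exists (x + r *: u); last first.
  by rewrite scalerDr scalerA mulVf ?gt_eqF// scale1r addrA -scalerDl addNr scale0r add0r.
move: u1; rewrite /eball/= -(ltr_pM2l r0) mulr1.
rewrite (_ : r * _ = eucl_dist x (x + r *: u))//.
rewrite /eucl_dist -{1}(ger0_norm (ltW r0)) -sqrtr_sqr -sqrtrM ?sqr_ge0// mulr_sumr.
by congr Num.sqrt; apply: eq_bigr => i _; rewrite !mxE; ring.
Qed.

End Euclid.

Lemma finite_int_ball (N : nat) : finite_set [set j : int | `|j| < N%:Z].
Proof.
apply: (@sub_finite_set _ _ [set (m%:Z - N%:Z)%R | m in `I_(2 * N)]).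
  by move=> j /= jN; exists (absz (j + N%:Z)) => /=; lia.
exact/finite_image/finite_II.
Qed.

Lemma int_eq_or_pred (j m : int) : j < m + 1 -> m < j + 2 -> j = m \/ j = m - 1.
Proof. lia. Qed.

(** * Slabs inside balls *)

Section Slabs.
Variable R : realType.

Lemma esum_le_two (I : choiceType) (J : set I) (a : I -> \bar R) (l m : I) :
  (forall j, 0 <= a j)%E -> (forall j, j != l -> j != m -> a j = 0%E) ->
  (\esum_(j in J) a j <= a l + a m)%E.
Proof.
move=> a0 alm; pose b (c j : I) := if j == c then a c else 0%E.
have b0 c j : (0 <= b c j)%E by rewrite /b; case: ifP.
have ab j : (a j <= b l j + b m j)%E.
  rewrite /b; have [->|jl] := eqVneq j l; first by rewrite leeDl//; case: ifP.
  by have [->|jm] := eqVneq j m; rewrite ?add0e// alm.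
have bs c s : uniq s -> (\sum_(j <- s) b c j <= a c)%E.
  move=> us; have [cs|cs] := boolP (c \in s).
    rewrite (bigD1_seq c)//= big1 ?adde0 /b ?eqxx// => i /negbTE ->.
    by [].
  by rewrite big_seq big1// => i si; rewrite /b; case: eqP => // E; rewrite -E si in cs.
apply: ge_ereal_sup => _ [A [fA _] <-]; rewrite fsbig_finite//=.
apply: (@le_trans _ _ (\sum_(j <- finmap.enum_fset (fset_set A)) (b l j + b m j))%E).
  by apply: lee_sum => j _; exact: ab.
by rewrite big_split/= leeD// bs// finmap.fset_uniq.
Qed.

Lemma eball_col' (n : nat) (i : 'I_n.+1) (x u : 'rV[R]_n.+1) r :
  eball x r u -> eball (col' i x) r (col' i u).
Proof.
rewrite /eball/=; apply: le_lt_trans; rewrite ler_sqrt ?sum_sqr_ge0//.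
rewrite [leRHS](bigD1_ord i)//= (eq_bigr (fun j => (x 0 (lift i j) - u 0 (lift i j)) ^+ 2)).
  by rewrite lerDr sqr_ge0.
by move=> j _; rewrite !mxE.
Qed.

(** The projection of the ball along [i] lies in a ball of dimension [n.+1], so [leb_outer_slab]
    applies with the volume of the latter. *)
Lemma leb_outer_slab_eball (n : nat) (i : 'I_n.+2) (E : set 'rV[R]_n.+2) x (r t C : R) :
  0 < r -> 0 <= t -> 0 <= C -> E `<=` eball x r ->
  (forall u v h, E u -> E v ->
     (forall j, j != i -> `|u 0 j - v 0 j| <= h) -> u 0 i - v 0 i <= t + C * h) ->
  (leb_outer E <= (t * (r ^+ n.+1 * unit_ball_vol R n.+1))%:E)%E.
Proof.
move=> r0 t0 C0 Ex osc.
apply: (@leb_outer_slab _ _ i E (eball (col' i x) r) t C) => //.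
  by rewrite leb_outer_eball.
by move=> u /Ex; exact: eball_col'.
Qed.

Lemma leb_outer_null_graph (n : nat) (i : 'I_n.+2) (E : set 'rV[R]_n.+2) (r C : R) :
  0 < r -> 0 <= C -> E `<=` eball 0 r ->
  (forall u v h, E u -> E v ->
     (forall j, j != i -> `|u 0 j - v 0 j| <= h) -> u 0 i - v 0 i <= C * h) ->
  (leb_outer E <= 0)%E.
Proof.
move=> r0 C0 Er osc; have := @leb_outer_slab_eball n i E 0 r 0 C r0 (lexx 0) C0 Er.
by rewrite mul0r; apply => u v h Eu Ev H; rewrite add0r; exact: osc.
Qed.

Lemma unit_ball_vol_ge0 (k : nat) : 0 <= unit_ball_vol R k.
Proof. exact/fine_ge0/leb_outer_ge0. Qed.

End Slabs.

(** * Partial derivatives as limits of difference quotients *)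

Section PartialDerivatives.
Variable R : realType.

Lemma is_derive1P (q : R -> R) (x a : R) :
  is_derive x 1 q a <-> h^-1 * (q (h + x) - q x) @[h --> 0^'] --> a.
Proof.
have E : (fun h : R => h^-1 *: ((q \o shift x) (h *: 1) - q x)) =
         (fun h => h^-1 * (q (h + x) - q x)).
  by apply/funext => h /=; rewrite [h *: 1]mulr1.
split=> [[dq <-]|H].
  by move: dq; rewrite /derivable /derive E.
split; rewrite /derivable /derive E; first by apply/cvg_ex; exists a.
exact/cvg_lim.
Qed.

Variable k : nat.
Implicit Types (f : 'rV[R]_k -> R) (x p q : 'rV[R]_k).

(** Existence and value in one relation, because [pd] returns some value even where the derivative
    does not exist. *)
Definition is_pd (i : 'I_k) f x (a : R) :=
  is_derive (0 : R) (1 : R) (fun h : R => f (x + h *: evec R i)) a.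

Lemma is_pdP i f x a :
  is_pd i f x a <-> h^-1 * (f (x + h *: evec R i) - f x) @[h --> 0^'] --> a.
Proof.
rewrite /is_pd is_derive1P scale0r addr0.
by under [in X in X <-> _]eq_fun do rewrite addr0.
Qed.

Lemma has_pdP i f x : has_pd i f x -> is_pd i f x (pd i f x).
Proof. by move=> H; split=> //; rewrite /pd derive1E. Qed.

Lemma is_pd_has i f x a : is_pd i f x a -> has_pd i f x.
Proof. by case. Qed.

Lemma is_pd_val i f x a : is_pd i f x a -> pd i f x = a.
Proof. by move=> [? H]; rewrite /pd derive1E. Qed.

Lemma is_pd_line i f x s a : is_pd i f (x + s *: evec R i) a ->
  is_derive s 1 (fun h : R => f (x + h *: evec R i)) a.
Proof.
move=> /is_pdP H; apply/is_derive1P.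
by under eq_fun => h do rewrite scalerDl (addrC (h *: _)) addrA.
Qed.

Lemma eucl_dist_evec x i (h : R) : eucl_dist x (x + h *: evec R i) = `|h|.
Proof.
rewrite /eucl_dist (bigD1 i)//= big1 => [|j ji].
  by rewrite !mxE !eqxx addr0 mulr1 opprD addrA subrr add0r sqrrN sqrtr_sqr.
by rewrite !mxE (negbTE ji) andbF mulr0 addr0 subrr expr0n.
Qed.

Lemma near_evec (O : set 'rV[R]_k) x i : eopen O -> O x ->
  \forall h \near (0 : R)^', O (x + h *: evec R i).
Proof.
move=> oO /oO[r r0 rO]; near=> h; apply: rO; rewrite /eball/= eucl_dist_evec.
near: h; apply: nbhs_dnbhs.
by exists r => //= h; rewrite /ball/= sub0r normrN.
Unshelve. all: by end_near. Qed.

Lemma is_pd_congr (O : set 'rV[R]_k) i f g x a : eopen O -> O x ->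
  (forall y, O y -> f y = g y) -> is_pd i f x a -> is_pd i g x a.
Proof.
move=> oO Ox fg /is_pdP H; apply/is_pdP; move: H; apply: cvg_trans.
apply: near_eq_cvg; near=> h; rewrite !fg//; near: h; exact: near_evec.
Unshelve. all: by end_near. Qed.

Lemma is_pd_affine i f x a c d :
  is_pd i f x a -> is_pd i (fun y => c * f y + d) x (c * a).
Proof.
move=> /is_pdP H; apply/is_pdP.
rewrite (_ : (fun h => _) = (fun h => c * (h^-1 * (f (x + h *: evec R i) - f x)))).
  exact: cvgM (cvg_cst _) H.
by apply/funext => h; rewrite opprD addrACA subrr addr0 -mulrBr mulrCA.
Qed.

Lemma is_pd_coord i l (c : R) x : is_pd i (fun y => c * y 0 l) x (c * (l == i)%:R).
Proof.
apply/is_pdP; apply: cvg_near_cst.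
near=> h; rewrite !mxE eqxx/=.
have h0 : h != 0 by near: h; exact: nbhs_dnbhs_neq.
by field.
Unshelve. all: by end_near. Qed.

End PartialDerivatives.

(** * Continuity with respect to the Euclidean distance *)

Section Continuity.
Variables (R : realType) (k : nat).
Implicit Types (V : set 'rV[R]_k) (f g : 'rV[R]_k -> R) (x : 'rV[R]_k).

(** Links the library topology, generated by the sup norm, to Euclidean balls, so that library
    results on limits and compactness apply. *)
Lemma nbhs_eball x (A : set 'rV[R]_k) :
  nbhs x A <-> exists2 r : R, 0 < r & eball x r `<=` A.
Proof.
split=> [/nbhs_ballP[r /= r0 rA]|[r r0 rA]].
  exists r => // y xy; apply: rA; split=> // i j.
  rewrite /ball/= (ord1 i); exact: le_lt_trans (coord_le_dist _ _ _) xy.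
apply/nbhs_ballP; exists (r / (k.+1)%:R) => /=; first by rewrite divr_gt0.
move=> y [_ xy]; apply: rA; rewrite /eball/=.
apply: (@le_lt_trans _ _ (k%:R * (r / k.+1%:R))).
  by apply: eucl_dist_le_coord => [|i]; [rewrite ltW// divr_gt0|exact/ltW/xy].
by rewrite mulrCA gtr_pMr// ltr_pdivrMr ?ltr0n// mul1r ltr_nat.
Qed.

Lemma econt_onP V f :
  econt_on V f <-> forall x, V x -> f @ within V (nbhs x) --> f x.
Proof.
split=> [H x Vx|H x Vx e e0].
  apply/cvgrPdist_lt => e e0; have [d d0 Hd] := H x Vx e e0.
  apply/nbhs_eball; exists d => // y xy Vy; rewrite distrC; exact: Hd.
have /cvgrPdist_lt/(_ e e0)/nbhs_eball[d d0 Hd] := H x Vx.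
by exists d => // y Vy xy; rewrite distrC; exact: Hd.
Qed.

Lemma econt_on_sub V W f : V `<=` W -> econt_on W f -> econt_on V f.
Proof.
move=> VW H x Vx e e0; have [d d0 Hd] := H x (VW _ Vx) e e0.
by exists d => // y /VW; exact: Hd.
Qed.

Lemma econt_on_ext V f g : (forall x, V x -> f x = g x) -> econt_on V f -> econt_on V g.
Proof.
move=> fg H x Vx e e0; have [d d0 Hd] := H x Vx e e0.
by exists d => // y Vy xy; rewrite -!fg//; exact: Hd.
Qed.

Lemma econt_on_cst V c : econt_on V (fun=> c).
Proof. by move=> x Vx e e0; exists 1 => // *; rewrite subrr normr0. Qed.

Lemma econt_onD V f g : econt_on V f -> econt_on V g -> econt_on V (fun x => f x + g x).
Proof.
move=> /econt_onP cf /econt_onP cg; apply/econt_onP => x Vx.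
exact: cvgD (cf x Vx) (cg x Vx).
Qed.

Lemma econt_onM V f g : econt_on V f -> econt_on V g -> econt_on V (fun x => f x * g x).
Proof.
move=> /econt_onP cf /econt_onP cg; apply/econt_onP => x Vx.
exact: cvgM (cf x Vx) (cg x Vx).
Qed.

Lemma econt_onV V f : (forall x, V x -> f x != 0) ->
  econt_on V f -> econt_on V (fun x => (f x)^-1).
Proof.
move=> f0 /econt_onP cf; apply/econt_onP => x Vx.
exact: cvgV (f0 x Vx) (cf x Vx).
Qed.

Lemma econt_on_sum V (I : Type) (s : seq I) (F : I -> 'rV[R]_k -> R) :
  (forall i, econt_on V (F i)) -> econt_on V (fun x => \sum_(i <- s) F i x).
Proof.
move=> cF; elim: s => [|i s IH].
  by apply: (@econt_on_ext V _ _ _ (@econt_on_cst V 0)) => x _; rewrite big_nil.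
by apply: (@econt_on_ext V _ _ _ (econt_onD (cF i) IH)) => x _; rewrite big_cons.
Qed.

Lemma econt_on_comp V (W : set 'rV[R]_k) f (g : 'rV[R]_k -> 'rV[R]_k) M : 0 < M ->
  (forall x, V x -> W (g x)) ->
  (forall x y, V x -> V y -> eucl_dist (g x) (g y) <= M * eucl_dist x y) ->
  econt_on W f -> econt_on V (f \o g).
Proof.
move=> M0 VW lip cf x Vx e e0; have [d d0 Hd] := cf _ (VW _ Vx) e e0.
exists (d / M) => [|y Vy xy]; first by rewrite divr_gt0.
apply: Hd; first exact: VW.
by apply: (le_lt_trans (lip _ _ Vx Vy)); rewrite mulrC -ltr_pdivlMr.
Qed.

Lemma econt_on_bounded V f (A : 'I_k -> set R) :
  (forall i, compact (A i)) -> [set x : 'rV[R]_k | forall i, A i (x 0 i)] `<=` V ->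
  econt_on V f ->
  exists M, forall x, (forall i, A i (x 0 i)) -> `|f x| <= M.
Proof.
move=> cA AV cf; set B := [set x : 'rV[R]_k | forall i, A i (x 0 i)] in AV.
have cB : compact B by exact: rV_compact.
have [B0|B0] := pselect (B !=set0); last first.
  by exists 0 => x Ax; exfalso; apply: B0; exists x.
have cfB : {within B, continuous (fun x => `|f x|)}.
  apply/subspace_continuousP => y By.
  have /econt_onP/(_ y By) := econt_on_sub AV cf.
  exact: cvg_norm.
have [c _ H] := EVT_max_rV B0 cB cfB.
by exists `|f c| => x Ax; apply: H; rewrite inE.
Qed.

End Continuity.

(** * Mean value theorem and chain rule, one coordinate at a time *)

Section MeanValue.
Variables (R : realType) (k : nat).
Implicit Types (D O : set 'rV[R]_k) (f : 'rV[R]_k -> R) (x p q r : 'rV[R]_k).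

Definition between p q r :=
  forall i, p 0 i <= r 0 i <= q 0 i \/ q 0 i <= r 0 i <= p 0 i.

(** Ordinary convexity would not do: the paths used below change one coordinate at a time and leave
    the segment from [p] to [q]. *)
Definition hull_closed D := forall p q r, D p -> D q -> between p q r -> D r.

Lemma dist_between p q r : between p q r -> eucl_dist q r <= eucl_dist q p.
Proof.
move=> H; rewrite ler_sqrt ?sum_sqr_ge0//; apply: ler_sum => i _.
rewrite -[leLHS]real_normK ?num_real// -[leRHS]real_normK ?num_real//.
rewrite lerXn2r ?nnegrE ?normr_ge0//.
case: (H i) => /andP[h1 h2].
  by rewrite !ger0_norm; lra.
by rewrite !ler0_norm; lra.
Qed.

Lemma mvt_line i f x t :
  (forall s, 0 <= s <= t \/ t <= s <= 0 -> has_pd i f (x + s *: evec R i)) ->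
  exists2 s, 0 <= s <= t \/ t <= s <= 0 &
    f (x + t *: evec R i) - f x = pd i f (x + s *: evec R i) * t.
Proof.
move=> H; pose Q (h : R) := f (x + h *: evec R i).
pose dQ (h : R) := pd i f (x + h *: evec R i).
have dQP s : 0 <= s <= t \/ t <= s <= 0 -> is_derive s 1 Q (dQ s).
  by move=> /H/has_pdP/is_pd_line.
have Q0 : Q 0 = f x by rewrite /Q scale0r addr0.
have [t0|t0] := leP 0 t.
  have [||s] := @MVT_segment R Q dQ 0 t t0.
  - by move=> s; rewrite in_itv/= => /andP[? ?]; apply: dQP; left; apply/andP; split; lra.
  - apply: derivable_within_continuous => s; rewrite in_itv/= => hs.
    by have [] := dQP s (or_introl hs).
  by rewrite in_itv/= Q0 subr0 => hs E; exists s => //; left.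
have [||s] := @MVT_segment R Q dQ t 0 (ltW t0).
- by move=> s; rewrite in_itv/= => /andP[? ?]; apply: dQP; right; apply/andP; split; lra.
- apply: derivable_within_continuous => s; rewrite in_itv/= => hs.
  by have [] := dQP s (or_intror hs).
rewrite in_itv/= Q0 => hs E; exists s; first by right.
by rewrite -/(Q t) -/(dQ s); move: E; rewrite sub0r mulrN; lra.
Qed.

(** Telescoping along the points [P m], which take their first [m] coordinates from [p] and the
    others from [q]; each step is the one-variable theorem. The intermediate point therefore differs
    from one coordinate to another. *)
Lemma mvt_box D f p q : hull_closed D ->
  (forall i x, D x -> has_pd i f x) -> D p -> D q ->
  exists2 xi : 'I_k -> 'rV[R]_k, forall i, between p q (xi i) &
    f p - f q = \sum_i pd i f (xi i) * (p 0 i - q 0 i).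
Proof.
move=> hD df Dp Dq.
pose P (m : nat) : 'rV[R]_k := \row_j (if (j < m)%N then p 0 j else q 0 j).
have Pb i s : 0 <= s <= p 0 i - q 0 i \/ p 0 i - q 0 i <= s <= 0 ->
    between p q (P i + s *: evec R i).
  move=> hs j; rewrite !mxE eqxx/=; have [->|ji] := eqVneq j i.
    by rewrite ltnn mulr1; case: hs => /andP[? ?]; [right|left]; apply/andP; split; lra.
  rewrite mulr0 addr0; case: ifP => _; rewrite !lexx ?andbT;
    by case: (leP (p 0 j) (q 0 j)) => h; [left|right]; rewrite ?(ltW h).
have PS (i : 'I_k) : P i.+1 = P i + (p 0 i - q 0 i) *: evec R i.
  apply/rowP => j; rewrite !mxE eqxx/=; have [->|ji] := eqVneq j i.
    by rewrite ltnSn ltnn mulr1 addrC subrK.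
  by rewrite mulr0 addr0 ltnS leq_eqVlt -[(_ == _ :> nat)]/(j == i) (negbTE ji).
have step (i : 'I_k) : exists s : R, between p q (P i + s *: evec R i) /\
    f (P i.+1) - f (P i) = pd i f (P i + s *: evec R i) * (p 0 i - q 0 i).
  have [|s hs E] := @mvt_line i f (P i) (p 0 i - q 0 i).
    by move=> s hs; apply: df; apply: (hD p q) => //; exact: Pb.
  by exists s; split; [exact: Pb|rewrite PS].
have [s Hs] := choice step.
exists (fun i : 'I_k => P i + s i *: evec R i) => [i|]; first exact: (Hs i).1.
have -> : p = P k by apply/rowP => j; rewrite mxE ltn_ord.
have -> : q = P 0%N by apply/rowP => j; rewrite mxE.
rewrite -(telescope_sumr (fun m => f (P m)))// big_mkord.
apply: eq_bigr => i _; rewrite (Hs i).2; congr (_ * _).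
by rewrite !mxE ltn_ord.
Qed.

Lemma mvt_lipschitz D f p q M h : hull_closed D ->
  (forall i x, D x -> has_pd i f x) -> (forall i x, D x -> `|pd i f x| <= M) ->
  D p -> D q -> (forall i, `|p 0 i - q 0 i| <= h) ->
  `|f p - f q| <= k%:R * M * h.
Proof.
move=> hD df bf Dp Dq hpq; have [xi bxi ->] := mvt_box hD df Dp Dq.
apply: (le_trans (ler_norm_sum _ _ _)).
apply: (@le_trans _ _ (\sum_(i < k) M * h)); last first.
  by rewrite sumr_const card_ord -[leLHS]mulr_natl mulrA.
apply: ler_sum => i _; rewrite normrM; apply: ler_pM => //.
by apply: bf; exact: hD (bxi i).
Qed.

Lemma cvg_econt D f p (c : R -> 'rV[R]_k) M : econt_on D f -> D p ->
  (\forall h \near (0 : R)^', D (c h)) ->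
  (\forall h \near (0 : R)^', eucl_dist p (c h) <= M * `|h|) ->
  f (c h) @[h --> (0 : R)^'] --> f p.
Proof.
move=> cf Dp nD nd; apply/cvgrPdist_lt => e e0.
have [d d0 Hd] := cf p Dp e e0.
have dM : 0 < d / (`|M| + 1) by rewrite divr_gt0// ltr_wpDl.
near=> h; rewrite distrC; apply: Hd; first by near: h.
have h1 : eucl_dist p (c h) <= M * `|h| by near: h.
apply: (le_lt_trans h1).
have h2 : `|h| < d / (`|M| + 1).
  near: h; apply: nbhs_dnbhs; exists (d / (`|M| + 1)) => //= h.
  by rewrite /ball/= sub0r normrN.
apply: (@le_lt_trans _ _ ((`|M| + 1) * `|h|)).
  by rewrite ler_wpM2r// (le_trans (ler_norm _))// lerDl.
by rewrite mulrC -ltr_pdivlMr// ltr_wpDl.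
Unshelve. all: by end_near. Qed.

Lemma cvg_sum_dnbhs (I : Type) (s : seq I) (F : I -> R -> R) (a : I -> R) :
  (forall i, F i h @[h --> (0 : R)^'] --> a i) ->
  \sum_(i <- s) F i h @[h --> (0 : R)^'] --> \sum_(i <- s) a i.
Proof.
move=> cF; elim: s => [|i s IH].
  under eq_fun do rewrite big_nil.
  by rewrite big_nil; exact: cvg_cst.
under eq_fun do rewrite big_cons.
by rewrite big_cons; exact: cvgD.
Qed.

(** [mvt_box] between [c h] and [p] expresses the quotient through partial derivatives at
    intermediate points, which tend to [p] by [dist_between]; continuity of the partial derivatives
    gives the limit. *)
Lemma cvg_chain D f p (c : R -> 'rV[R]_k) (d : 'I_k -> R) M : hull_closed D ->
  (forall i x, D x -> has_pd i f x) -> (forall i, econt_on D (pd i f)) -> D p ->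
  (\forall h \near (0 : R)^', D (c h)) ->
  (\forall h \near (0 : R)^', eucl_dist p (c h) <= M * `|h|) ->
  (forall l, h^-1 * (c h 0 l - p 0 l) @[h --> (0 : R)^'] --> d l) ->
  h^-1 * (f (c h) - f p) @[h --> (0 : R)^'] --> \sum_l pd l f p * d l.
Proof.
move=> hD df cdf Dp nD nd cd.
have /choice[xi Hxi] : forall h : R, exists xi : 'I_k -> 'rV[R]_k, D (c h) ->
    (forall i, between (c h) p (xi i)) /\
    f (c h) - f p = \sum_i pd i f (xi i) * (c h 0 i - p 0 i).
  move=> h; have [Dh|nDh] := pselect (D (c h)); last by exists (fun=> p).
  by have [xi ? ?] := mvt_box hD df Dh Dp; exists xi.
have : \sum_l pd l f (xi h l) * (h^-1 * (c h 0 l - p 0 l)) @[h --> (0 : R)^'] -->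
    \sum_l pd l f p * d l.
  apply: cvg_sum_dnbhs => l; apply: cvgM (cd l).
  apply: (@cvg_econt D _ _ (fun h => xi h l) M) => //.
    near=> h; have Dh : D (c h) by near: h.
    by have [/(_ l) b _] := Hxi h Dh; exact: hD b.
  near=> h; have Dh : D (c h) by near: h.
  have [/(_ l) b _] := Hxi h Dh; apply: (le_trans (dist_between b)).
  by near: h.
apply: cvg_trans; apply: near_eq_cvg; near=> h.
have Dh : D (c h) by near: h.
by have [_ ->] := Hxi h Dh; rewrite mulr_sumr; apply: eq_bigr => l _; rewrite mulrCA.
Unshelve. all: by end_near. Qed.

End MeanValue.

(** * Algebra of C^1 functions and criteria for C^2 regularity *)

Section Smoothness.
Variables (R : realType) (k : nat).
Implicit Types (D O : set 'rV[R]_k) (f g : 'rV[R]_k -> R) (x p q r : 'rV[R]_k).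

Definition C1_on D f := exists f1 : 'I_k -> 'rV[R]_k -> R,
  [/\ econt_on D f, forall i x, D x -> is_pd i f x (f1 i x)
    & forall i, econt_on D (f1 i)].

Lemma C1_on_cst D c : C1_on D (fun=> c).
Proof.
exists (fun _ _ => 0); split=> [|i x _|i]; try exact: econt_on_cst.
exact: is_derive_cst.
Qed.

Lemma C1_onD D f g : C1_on D f -> C1_on D g -> C1_on D (fun x => f x + g x).
Proof.
move=> [f1 [cf df cf1]] [g1 [cg dg cg1]].
exists (fun i x => f1 i x + g1 i x); split=> [|i x Dx|i]; try exact: econt_onD.
exact: is_deriveD (df i x Dx) (dg i x Dx).
Qed.

Lemma C1_onM D f g : C1_on D f -> C1_on D g -> C1_on D (fun x => f x * g x).
Proof.
move=> [f1 [cf df cf1]] [g1 [cg dg cg1]].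
exists (fun i x => f x * g1 i x + g x * f1 i x); split=> [|i x Dx|i].
- exact: econt_onM.
- have := is_deriveM (df i x Dx) (dg i x Dx).
  by rewrite !scale0r !addr0.
- by apply: econt_onD; exact: econt_onM.
Qed.

Lemma C1_onV D f : (forall x, D x -> f x != 0) ->
  C1_on D f -> C1_on D (fun x => (f x)^-1).
Proof.
move=> f0 [f1 [cf df cf1]].
exists (fun i x => - (f x)^-1 * (f x)^-1 * f1 i x); split=> [|i x Dx|i].
- exact: econt_onV.
- have := @is_deriveV _ (fun h => f (x + h *: evec R i)) 0 (f1 i x) 1 _ (df i x Dx).
  rewrite !scale0r !addr0 => /(_ (f0 x Dx)).
  by rewrite /is_pd -exprVn expr2 -mulNr.
- apply: econt_onM => //; apply: econt_onM; last exact: econt_onV.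
  apply: (@econt_on_ext _ _ _ (fun x => -1 * (f x)^-1)).
    by move=> x _; rewrite mulN1r.
  by apply: econt_onM (econt_onV f0 cf); exact: econt_on_cst.
Qed.

Lemma C1_on_sum D (I : Type) (s : seq I) (F : I -> 'rV[R]_k -> R) :
  (forall i, C1_on D (F i)) -> C1_on D (fun x => \sum_(i <- s) F i x).
Proof.
move=> cF; elim: s => [|i s IH].
  under eq_fun do rewrite big_nil.
  exact: C1_on_cst.
under eq_fun do rewrite big_cons.
exact: C1_onD.
Qed.

(** The candidate [f1 i] agrees with [pd i f] only on [O]; openness of [O] is what transfers its
    derivatives to [pd i f]. *)
Lemma C2_scal_intro O f (f1 : 'I_k -> 'rV[R]_k -> R)
    (f2 : 'I_k -> 'I_k -> 'rV[R]_k -> R) : eopen O ->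
  econt_on O f ->
  (forall i x, O x -> is_pd i f x (f1 i x)) -> (forall i, econt_on O (f1 i)) ->
  (forall i j x, O x -> is_pd j (f1 i) x (f2 i j x)) ->
  (forall i j, econt_on O (f2 i j)) ->
  C2_scal O f.
Proof.
move=> oO cf df cf1 df1 cf2.
have f1E i x : O x -> f1 i x = pd i f x by move=> Ox; rewrite (is_pd_val (df i x Ox)).
have dpd i j x : O x -> is_pd j (pd i f) x (f2 i j x).
  by move=> Ox; apply: (is_pd_congr oO Ox (f1E i)); exact: df1.
split=> // [i|i j].
  split=> [x Ox|]; first exact: is_pd_has (df i x Ox).
  exact: econt_on_ext (f1E i) (cf1 i).
split=> [x Ox|]; first exact: is_pd_has (dpd i j x Ox).
apply: econt_on_ext (cf2 i j) => x Ox.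
by rewrite (is_pd_val (dpd i j x Ox)).
Qed.

(* [g] solves the first order system [d_i g_l = G l i (g w)] with [G] of class
   C^1, so differentiating the system once more gives its second derivatives. *)
Lemma C2_on_autonomous D O (g : 'rV[R]_k -> 'rV[R]_k)
    (G : 'I_k -> 'I_k -> 'rV[R]_k -> R) M : 0 < M ->
  hull_closed D -> eopen O -> (forall w, O w -> D (g w)) ->
  (forall x y, O x -> O y -> eucl_dist (g x) (g y) <= M * eucl_dist x y) ->
  (forall l i, C1_on D (G l i)) ->
  (forall l i w, O w -> is_pd i (coordfun g l) w (G l i (g w))) ->
  C2_on O g.
Proof.
move=> M0 hD oO OD lip C1G dg l.
have pdG l' i m x : D x -> has_pd m (G l' i) x.
  by move=> Dx; have [G1 [_ /(_ m x Dx)/is_pd_has]] := C1G l' i.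
have cG l' i : econt_on D (G l' i) by have [? []] := C1G l' i.
have cpdG l' i m : econt_on D (pd m (G l' i)).
  have [G1 [_ dG cG1]] := C1G l' i.
  by apply: econt_on_ext (cG1 m) => x Dx; rewrite (is_pd_val (dG m x Dx)).
have comp f : econt_on D f -> econt_on O (f \o g) by exact: econt_on_comp OD lip.
apply: (@C2_scal_intro O _ (fun i => G l i \o g)
  (fun i j w => \sum_m pd m (G l i) (g w) * G m j (g w))) => //.
- move=> x Ox e e0; exists (e / M) => [|y Oy xy]; first by rewrite divr_gt0.
  rewrite /coordfun distrC; apply: le_lt_trans (coord_le_dist _ _ _) _.
  by apply: (le_lt_trans (lip _ _ Ox Oy)); rewrite mulrC -ltr_pdivlMr.
- by move=> i x; exact: dg.
- by move=> i; exact: comp.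
- move=> i j x Ox; apply/is_pdP.
  apply: (@cvg_chain _ _ D _ (g x) (fun h => g (x + h *: evec R j)) _ M) => //.
  + by move=> m y; exact: pdG.
  + exact: OD.
  + by near=> h; apply: OD; near: h; exact: near_evec.
  + near=> h; rewrite -(eucl_dist_evec x j h); apply: lip => //.
    by near: h; exact: near_evec.
  + by move=> m; apply/(is_pdP j (coordfun g m)); exact: dg.
- move=> i j; apply: econt_on_sum => m; apply: econt_onM.
    exact: comp.
  exact: comp.
Unshelve. all: by end_near. Qed.

End Smoothness.

(** * The rescaling [Gam] and the boxes [Omega_r] *)

Section Rescaling.
Variables (R : realType) (k : nat) (gam : R).
Hypothesis gam0 : 0 < gam.
Implicit Types (u v : 'rV[R]_k).

Lemma ler_norm_addB (x y : R) : `|y| <= `|x| + `|x - y|.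
Proof. by have := ler_normB x (x - y); rewrite opprB addrC subrK. Qed.

Lemma Gam_evec u h (i : 'I_k) :
  Gam gam (u + h *: evec R i) = Gam gam u + (gam ^- i * h) *: evec R i.
Proof.
apply/rowP => j; rewrite !mxE eqxx/=; have [->|ji] := eqVneq j i; last first.
  by rewrite !mulr0 !addr0.
by rewrite !mulr1 mulrDr.
Qed.

Lemma is_pd_Gam i f u a :
  is_pd i f (Gam gam u) a -> is_pd i (f \o Gam gam) u (gam ^- i * a).
Proof.
move=> H; rewrite /is_pd.
have -> : (fun h => (f \o Gam gam) (u + h *: evec R i)) =
    (fun h => f (Gam gam u + h *: evec R i)) \o (fun h : R => gam ^- i * h).
  by apply/funext => h /=; rewrite Gam_evec.
have dl : is_derive (0 : R) (1 : R) (fun h : R => gam ^- i * h) (gam ^- i).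
  apply/is_derive1P; apply: cvg_near_cst; near=> h.
  have h0 : h != 0 by near: h; exact: nbhs_dnbhs_neq.
  by rewrite addr0 mulr0 subr0 mulrCA mulVf// mulr1.
have H' : is_derive (gam ^- i * 0 : R) (1 : R)
    (fun h => f (Gam gam u + h *: evec R i)) a by rewrite mulr0.
by have := @is_derive1_comp _ _ _ (0 : R) _ _ H' dl; rewrite mulrC.
Unshelve. all: by end_near. Qed.

Lemma norm_Gam u (i : 'I_k) : `|Gam gam u 0 i| = `|u 0 i| / gam ^+ i.
Proof. by rewrite mxE normrM normfV (gtr0_norm (exprn_gt0 i gam0)) mulrC. Qed.

Lemma Omega_rP L r u :
  Omega_r gam L r u <-> forall i, `|u 0 i| < gam ^+ i * (L + r).
Proof.
by split=> H i; have := H i;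
  rewrite -ltr_norml norm_Gam ltr_pdivrMr ?exprn_gt0// [_ * gam ^+ i]mulrC.
Qed.

Lemma OmegaP L u : Omega gam L u <-> forall i, `|u 0 i| <= gam ^+ i * L.
Proof.
by split=> H i; have := H i;
  rewrite -ler_norml norm_Gam ler_pdivrMr ?exprn_gt0// [_ * gam ^+ i]mulrC.
Qed.

Lemma hull_closed_Omega_r L r : hull_closed (Omega_r gam L r : set 'rV[R]_k).
Proof.
move=> p q s /Omega_rP Hp /Omega_rP Hq b; apply/Omega_rP => i.
have := Hp i; have := Hq i; rewrite !ltr_norml => /andP[? ?] /andP[? ?].
by case: (b i) => /andP[? ?]; apply/andP; split; lra.
Qed.

Hypothesis gam1 : gam < 1.

Lemma gam_exp_le (i j : nat) : (i <= j)%N -> gam ^+ j <= gam ^+ i.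
Proof. by move=> ij; apply: ler_wiXn2l => //; exact: ltW. Qed.

(** Passing from [r] to [s] moves the faces in direction [i] by [gam ^+ i * (s - r)], and [gam ^+ k]
    bounds all these factors from below. *)
Lemma eball_Omega_r L r s u e : Omega_r gam L r u -> e <= gam ^+ k * (s - r) -> r <= s ->
  eball u e `<=` Omega_r gam L s.
Proof.
move=> /Omega_rP Hu ers rs v; rewrite /eball/= => uv; apply/Omega_rP => i.
have h1 := coord_le_dist u v i; have h2 := Hu i.
have h3 := ler_norm_addB (u 0 i) (v 0 i).
have h4 : gam ^+ k * (s - r) <= gam ^+ i * (s - r).
  by rewrite ler_wpM2r ?subr_ge0// gam_exp_le// ltnW.
have -> : gam ^+ i * (L + s) = gam ^+ i * (L + r) + gam ^+ i * (s - r) by ring.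
lra.
Qed.

Lemma eopen_Omega_r L r : eopen (Omega_r gam L r : set 'rV[R]_k).
Proof.
move=> u /Omega_rP Hu.
have : exists2 d : R, 0 < d & forall i : 'I_k, `|u 0 i| + d <= gam ^+ i * (L + r).
  pose d := \big[Num.min/1]_(i < k) (gam ^+ i * (L + r) - `|u 0 i|).
  exists d; last by move=> i; rewrite addrC -lerBrDr /d (bigD1 i)//= ge_min lexx.
  by apply: (big_ind (fun x => 0 < x)) => // [x y x0 y0|i _]; rewrite ?lt_min ?x0// subr_gt0.
move=> [d d0 Hd]; exists d => // v uv; apply/Omega_rP => i.
have h1 := coord_le_dist u v i; have h2 := Hd i.
have h3 := ler_norm_addB (u 0 i) (v 0 i).
move: uv; rewrite /eball/=; lra.
Qed.

Lemma eucl_dist_Gam u v :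
  eucl_dist (Gam gam u) (Gam gam v) <= k.+1%:R * gam ^- k * eucl_dist u v.
Proof.
have gk (j : nat) : 0 < gam ^+ j by rewrite exprn_gt0.
apply: (@le_trans _ _ (k%:R * (gam ^- k * eucl_dist u v))).
  apply: eucl_dist_le_coord => [|i].
    by rewrite mulr_ge0 ?eucl_dist_ge0// invr_ge0 ltW.
  rewrite !mxE -mulrBr normrM; apply: ler_pM => //; last exact: coord_le_dist.
  by rewrite gtr0_norm ?invr_gt0// lef_pV2 ?posrE// gam_exp_le// ltnW.
rewrite -mulrA ler_wpM2r// ?ler_nat//.
by rewrite mulr_ge0 ?eucl_dist_ge0// invr_ge0 ltW.
Qed.

Lemma econt_on_Gam a (f : 'rV[R]_k -> R) : econt_on (ocube a) f ->
  econt_on [set u | ocube a (Gam gam u)] (f \o Gam gam).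
Proof.
apply: (@econt_on_comp _ _ _ _ _ _ (k.+1%:R * gam ^- k)) => //.
  by rewrite mulr_gt0// invr_gt0 exprn_gt0.
by move=> x y _ _; exact: eucl_dist_Gam.
Qed.

Lemma finite_bound (I : finType) (T : Type) (A : set T) (f : I -> T -> R) :
  (forall i, exists M, forall x, A x -> `|f i x| <= M) ->
  exists M, forall i x, A x -> `|f i x| <= M.
Proof.
move=> /choice[M HM]; exists (\sum_i `|M i|) => i x Ax.
apply: (le_trans (HM i x Ax)); rewrite (bigD1 i)//=.
by rewrite (le_trans (ler_norm _))// lerDl sumr_ge0.
Qed.

Lemma econt_on_Omega_bounded L r s f : r < s -> 0 < L + s ->
  econt_on (Omega_r gam L s) f ->
  exists M, forall u : 'rV[R]_k, Omega_r gam L r u -> `|f u| <= M.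
Proof.
move=> rs Ls cf.
pose A (i : 'I_k) := [set` `[(- (gam ^+ i * (L + r))), (gam ^+ i * (L + r))]] : set R.
have [|||M HM] := @econt_on_bounded _ _ (Omega_r gam L s) f A.
- by move=> i; exact: segment_compact.
- move=> u Au; apply/Omega_rP => i.
  have := Au i; rewrite /A/= in_itv/= -ler_norml => h.
  by apply: (le_lt_trans h); rewrite ltr_pM2l ?exprn_gt0//; lra.
- by [].
exists M => u /Omega_rP Hu; apply: HM => i.
by rewrite /A/= in_itv/= -ler_norml ltW.
Qed.

End Rescaling.

(* [((C2 - 1) s - t)^2 >= 0] with [s = A * x + B] and [t = - B]. *)
Lemma expansion_ineq (R : realType) (sigma C1 C2 A B x Y : R) :
  0 < sigma -> 1 < C2 -> 0 <= Y ->
  C2 * sigma <= A ^+ 2 -> B ^+ 2 <= (C1 - 1) * (C2 - 1) * sigma * Y ->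
  sigma * (x ^+ 2 + Y) <= C1 * sigma * Y + (A * x + B) ^+ 2.
Proof.
move=> s0 C21 Y0 hA hB.
have h1 : C2 * sigma * x ^+ 2 <= A ^+ 2 * x ^+ 2 by rewrite ler_wpM2r ?sqr_ge0.
have h2 : 0 <= ((C2 - 1) * (A * x + B) + B) ^+ 2 by exact: sqr_ge0.
have c0 : 0 < C2 * (C2 - 1) by apply: mulr_gt0; lra.
have h3 : (C2 - 1) * (C2 * sigma * x ^+ 2) <= (C2 - 1) * (A ^+ 2 * x ^+ 2).
  by rewrite ler_wpM2l//; lra.
have h4 : C2 * B ^+ 2 <= C2 * ((C1 - 1) * (C2 - 1) * sigma * Y).
  by rewrite ler_wpM2l//; lra.
rewrite -(ler_pM2l c0).
have E : C2 * (C2 - 1) * (A * x + B) ^+ 2 + C2 * B ^+ 2 - (C2 - 1) * (A ^+ 2 * x ^+ 2)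
   = ((C2 - 1) * (A * x + B) + B) ^+ 2 by ring.
rewrite -subr_ge0.
have -> : C2 * (C2 - 1) * (C1 * sigma * Y + (A * x + B) ^+ 2) -
    C2 * (C2 - 1) * (sigma * (x ^+ 2 + Y)) =
  (C2 * (C2 - 1) * (A * x + B) ^+ 2 + C2 * ((C1 - 1) * (C2 - 1) * sigma * Y))
  - (C2 - 1) * (C2 * sigma * x ^+ 2) by ring.
lra.
Qed.

(** * Derivatives of [F] and their bounds *)

Section ExpandingMap.
Variables (R : realType) (n : nat) (L beta gam sigma C1 C2 : R).
Variable Phi0 : 'rV[R]_n.+2 -> R.
Hypotheses (L0 : 0 < L) (beta0 : 0 < beta).
Hypothesis smooth_Phi : C2_scal (ocube (L + beta)) Phi0.
Hypotheses (sigma1 : 1 < sigma) (C11 : 1 < C1) (C21 : 1 < C2).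
Hypotheses (gam0 : 0 < gam) (gamE : gam ^- 2 = C1 * sigma).
Hypothesis pd0_Phi : forall x, ocube (L + beta) x ->
  C1 ^+ n.+1 * C2 * sigma ^+ n.+2 <= (pd ord0 Phi0 x) ^+ 2.
Hypothesis pdi_Phi : forall x, ocube (L + beta) x -> forall i : 'I_n.+2, (0 < i)%N ->
  (pd i Phi0 x) ^+ 2 <= (C1 - 1) * (C2 - 1) / n.+1%:R * sigma.

Notation D := (Omega_r gam L beta : set 'rV[R]_n.+2).

Definition F (u : 'rV[R]_n.+2) : R := Phi0 (Gam gam u).
Definition F1 (i : 'I_n.+2) (u : 'rV[R]_n.+2) : R := gam ^- i * pd i Phi0 (Gam gam u).
Definition F2 (i j : 'I_n.+2) (u : 'rV[R]_n.+2) : R :=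
  gam ^- i * (gam ^- j * pd j (pd i Phi0) (Gam gam u)).

Let C1_gt0 : 0 < C1 := lt_trans ltr01 C11.
Let sigma_gt0 : 0 < sigma := lt_trans ltr01 sigma1.

Lemma gam_lt1 : gam < 1.
Proof.
rewrite ltNge; apply/negP => g1.
have : gam ^- 2 <= 1 by rewrite invf_le1 ?exprn_gt0// exprn_ege1.
rewrite gamE; have : 1 < C1 * sigma by exact: mulr_egt1.
lra.
Qed.

Lemma is_pd_F i u : D u -> is_pd i F u (F1 i u).
Proof.
move=> Du; have [_ /(_ i)[/(_ _ Du) H _] _] := smooth_Phi.
exact: is_pd_Gam (has_pdP H).
Qed.

Lemma is_pd_F1 i j u : D u -> is_pd j (F1 i) u (F2 i j u).
Proof.
move=> Du.
have H : is_pd j (pd i Phi0 \o Gam gam) u (gam ^- j * pd j (pd i Phi0) (Gam gam u)).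
  have [_ _ /(_ i j)[/(_ _ Du) K _]] := smooth_Phi.
  exact: is_pd_Gam (has_pdP K).
have := is_pd_affine (gam ^- i) 0 H.
by rewrite (_ : (fun y => _) = F1 i)//; apply/funext => y; rewrite addr0.
Qed.

Lemma econt_F : econt_on D F.
Proof. by have [H _ _] := smooth_Phi; exact: econt_on_Gam gam_lt1 _ _ H. Qed.

Lemma econt_F1 i : econt_on D (F1 i).
Proof.
apply: econt_onM; first exact: econt_on_cst.
by have [_ /(_ i)[_ H] _] := smooth_Phi; exact: econt_on_Gam gam_lt1 _ _ H.
Qed.

Lemma econt_F2 i j : econt_on D (F2 i j).
Proof.
apply: econt_onM; first exact: econt_on_cst.
apply: econt_onM; first exact: econt_on_cst.
by have [_ _ /(_ i j)[_ H]] := smooth_Phi; exact: econt_on_Gam gam_lt1 _ _ H.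
Qed.

Lemma pd_F i u : D u -> pd i F u = F1 i u.
Proof. by move=> /(is_pd_F i)/is_pd_val. Qed.

Lemma has_pd_F i u : D u -> has_pd i F u.
Proof. by move=> /(is_pd_F i)/is_pd_has. Qed.

Lemma C1_on_F1 i : C1_on D (F1 i).
Proof.
exists (F2 i); split; [exact: econt_F1|by move=> j x; exact: is_pd_F1|].
by move=> j; exact: econt_F2.
Qed.

(** Since [gam ^- 2 = C1 * sigma], the square of [gam ^+ n.+1] is [(C1 * sigma) ^- n.+1], which
    reduces the lower bound on the first partial derivative of [Phi0] to [C2 * sigma]. *)
Lemma sqr_F1_0 u : D u -> C2 * sigma <= (gam ^+ n.+1 * F1 ord0 u) ^+ 2.
Proof.
move=> Du; rewrite /F1 expr0 invr1 mul1r exprMn.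
have g2 : gam ^+ n.+1 ^+ 2 = (C1 * sigma) ^- n.+1.
  by rewrite -gamE exprVn invrK exprAC.
have cs : 0 < (C1 * sigma) ^+ n.+1 by rewrite exprn_gt0// mulr_gt0.
rewrite g2 [leRHS]mulrC ler_pdivlMr// exprMn.
have := pd0_Phi Du; rewrite [sigma ^+ n.+2]exprSr; apply: le_trans.
by rewrite le_eqVlt; apply/orP; left; apply/eqP; ring.
Qed.

Lemma F1_0_ge1 u : D u -> 1 <= `|F1 ord0 u|.
Proof.
move=> Du; rewrite -(ler_pXn2r (n := 2))// ?nnegrE// real_normK ?num_real// expr1n.
have h1 := sqr_F1_0 Du.
have h2 : 1 <= C2 * sigma by apply: mulr_ege1; exact: ltW.
have h3 : (gam ^+ n.+1 * F1 ord0 u) ^+ 2 <= F1 ord0 u ^+ 2.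
  rewrite exprMn ler_piMl ?sqr_ge0// -exprM; apply: exprn_ile1; exact/ltW/gam_lt1 || exact/ltW.
lra.
Qed.

Lemma F1_0_neq0 u : D u -> F1 ord0 u != 0.
Proof. by move=> /F1_0_ge1; rewrite -normr_gt0; apply: lt_le_trans. Qed.

(** The chain rule contributes [gam ^- i] with [i <= n.+1], so its product with [gam ^+ n.+1] is a
    nonnegative power of [gam], hence at most 1. *)
Lemma sqr_F1_lift u (j : 'I_n.+1) : D u ->
  (gam ^+ n.+1 * F1 (lift ord0 j) u) ^+ 2 <= (C1 - 1) * (C2 - 1) / n.+1%:R * sigma.
Proof.
move=> Du; apply: le_trans (pdi_Phi Du (i := lift ord0 j) isT).
rewrite /F1 mulrA [leLHS]exprMn ler_piMl ?sqr_ge0//.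
have -> : gam ^+ n.+1 / gam ^+ lift ord0 j = gam ^+ (n.+1 - lift ord0 j).
  rewrite expfB_cond// ?gt_eqF//.
  by rewrite lift0 add0n ltn_ord.
by rewrite -exprM; apply: exprn_ile1; [exact: ltW|exact/ltW/gam_lt1].
Qed.

Lemma coordE (u : 'rV[R]_n.+2) (j : 'I_n.+1) : Defs.coord u j.+1 = u 0 (lift ord0 j).
Proof.
have H : (j.+1 < n.+2)%N by rewrite ltnS ltn_ord.
by rewrite /Defs.coord (insubT (fun i => (i < n.+2)%N) H)/=; congr (u _ _); exact: val_inj.
Qed.

Notation W := (Omega_r gam L (beta / 2) : set 'rV[R]_n.+2).

Lemma W_sub_D : W `<=` D.
Proof.
move=> u /(Omega_rP gam0) H; apply/(Omega_rP gam0) => i; apply: lt_trans (H i) _.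
by rewrite ltr_pM2l ?exprn_gt0// ltrD2l ltr_pdivrMr// mulrDr mulr1 ltrDl.
Qed.

(** Continuity on [D] yields bounds on a box whose closure is compact in [D], hence the half margin
    [beta / 2] in [W]. *)
Lemma derivative_bounds : exists M, [/\ 1 <= M,
  forall i u, W u -> `|F1 i u| <= M & forall i j u, W u -> `|F2 i j u| <= M].
Proof.
have rs : beta / 2 < beta by rewrite ltr_pdivrMr// mulrDr mulr1 ltrDl.
have Ls : 0 < L + beta by rewrite addr_gt0.
have [M1 H1] : exists M, forall i u, W u -> `|F1 i u| <= M.
  apply: finite_bound => i.
  exact: (econt_on_Omega_bounded gam0 rs Ls (econt_F1 i)).
have [M2 H2] : exists M, forall (ij : 'I_n.+2 * 'I_n.+2) u, W u -> `|F2 ij.1 ij.2 u| <= M.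
  apply: (@finite_bound _ _ _ _ (fun ij => F2 ij.1 ij.2)) => ij.
  exact: (econt_on_Omega_bounded gam0 rs Ls (econt_F2 ij.1 ij.2)).
exists (1 + `|M1| + `|M2|); split=> [|i u Wu|i j u Wu].
- by rewrite -addrA lerDl addr_ge0.
- apply: (le_trans (H1 i u Wu)); apply: (le_trans (ler_norm _)).
  by rewrite addrAC lerDr addr_ge0.
- apply: (le_trans (H2 (i, j) u Wu)); apply: (le_trans (ler_norm _)).
  by rewrite lerDr addr_ge0.
Qed.

Variable M : R.
Hypotheses (M1 : 1 <= M) (bound_F1 : forall i u, W u -> `|F1 i u| <= M).
Hypothesis bound_F2 : forall i j u, W u -> `|F2 i j u| <= M.

Lemma F_lipschitz p q h : W p -> W q -> (forall i, `|p 0 i - q 0 i| <= h) ->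
  `|F p - F q| <= n.+2%:R * M * h.
Proof.
apply: (mvt_lipschitz (hull_closed_Omega_r gam0 (r := beta / 2))).
  by move=> i x /W_sub_D; exact: has_pd_F.
by move=> i x Wx; rewrite pd_F; [exact: bound_F1|exact: W_sub_D].
Qed.

Lemma F1_0_lipschitz p q h : W p -> W q -> (forall i, `|p 0 i - q 0 i| <= h) ->
  `|F1 ord0 p - F1 ord0 q| <= n.+2%:R * M * h.
Proof.
apply: (mvt_lipschitz (hull_closed_Omega_r gam0 (r := beta / 2))).
  by move=> i x /W_sub_D/(is_pd_F1 ord0 i)/is_pd_has.
by move=> i x Wx; rewrite (is_pd_val (is_pd_F1 ord0 i (W_sub_D Wx))); exact: bound_F2.
Qed.

(** * Expansion and local surjectivity of a single branch *)

Section Map.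
Variables (theta : R) (l : int).
Notation T := (Tj gam L Phi0 theta l).
Notation wid := (widen_ord (leqnSn n.+1)).

Lemma T_widen u (j : 'I_n.+1) : T u 0 (wid j) = u 0 (lift ord0 j) / gam.
Proof.
by rewrite !mxE/= ltnS ltn_ord coordE eqSS ltn_eqF ?addr0.
Qed.

Lemma T_max u : T u 0 ord_max = gam ^+ n.+1 * (F u + theta - 2 * l%:~R * L).
Proof. by rewrite !mxE/= ltnn eqxx /F; ring. Qed.

Lemma sqr_dist_T p q : eucl_dist (T p) (T q) ^+ 2 =
  gam ^- 2 * \sum_(j < n.+1) (p 0 (lift ord0 j) - q 0 (lift ord0 j)) ^+ 2 +
  (gam ^+ n.+1 * (F p - F q)) ^+ 2.
Proof.
rewrite sqr_eucl_dist big_ord_recr/= !T_max mulr_sumr; congr (_ + _).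
  apply: eq_bigr => j _; rewrite !T_widen; field; exact: lt0r_neq0.
by congr (_ ^+ 2); ring.
Qed.

Lemma T_expanding p q : D p -> D q ->
  eucl_dist p q <= (Num.sqrt sigma)^-1 * eucl_dist (T p) (T q).
Proof.
move=> Dp Dq; have s0 := sigma_gt0.
have ss0 : 0 < Num.sqrt sigma by rewrite sqrtr_gt0.
rewrite mulrC ler_pdivlMr// mulrC.
rewrite -(ler_pXn2r (n := 2))// ?nnegrE ?mulr_ge0 ?eucl_dist_ge0 ?sqrtr_ge0//.
rewrite exprMn sqr_sqrtr ?(ltW s0)// sqr_dist_T sqr_eucl_dist big_ord_recl/= gamE.
set Y := \sum_(j < n.+1) _.
have [xi bxi ->] := mvt_box (hull_closed_Omega_r gam0 (r := beta)) has_pd_F Dp Dq.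
have Dxi i : D (xi i) by exact: hull_closed_Omega_r (bxi i).
(* The last coordinate of [T p - T q] takes the form [A * x + B], where [A * x] comes from the first
   coordinate and [B] collects the others. *)
rewrite big_ord_recl/= [gam ^+ n.+1 * (_ + _)]mulrDr [gam ^+ n.+1 * (_ * _)]mulrA pd_F//.
refine (@expansion_ineq R sigma C1 C2 (gam ^+ n.+1 * F1 ord0 (xi ord0)) _ _ Y s0 C21 _ _ _); first exact: sum_sqr_ge0.
  exact: sqr_F1_0.
rewrite mulr_sumr.
under eq_bigr => j _ do rewrite pd_F// mulrA.
(* Cauchy-Schwarz on [B]: the [n.+1] summands cancel the denominator in the bound on the
   derivatives. *)
apply: (le_trans (cauchy_schwarz_sum _ _ _)); rewrite -/Y ler_wpM2r ?sum_sqr_ge0//.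
apply: (@le_trans _ _ (\sum_(j < n.+1) (C1 - 1) * (C2 - 1) / n.+1%:R * sigma)).
  by apply: ler_sum => j _; exact: sqr_F1_lift.
rewrite sumr_const card_ord -[leLHS]mulr_natr le_eqVlt; apply/orP; left; apply/eqP.
by field; rewrite addrC natr1 pnatr_eq0.
Qed.

Lemma T_inj p q : D p -> D q -> T p = T q -> p = q.
Proof.
move=> Dp Dq E; have := T_expanding Dp Dq; rewrite E eucl_distxx mulr0 => d0.
apply/rowP => i; apply/eqP; rewrite -subr_eq0 -normr_le0.
exact: le_trans (coord_le_dist _ _ _) d0.
Qed.

Lemma ord_max_or_widen (i : 'I_n.+2) : i = ord_max \/ exists j, i = wid j.
Proof.
case: (unliftP ord_max i) => [j ->|->]; last by left.
by right; exists j; apply: val_inj; rewrite /= /bump leqNgt ltn_ord.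
Qed.

Lemma row_eq_T (w u : 'rV[R]_n.+2) :
  (forall j, w 0 (wid j) = u 0 (lift ord0 j) / gam) ->
  w 0 ord_max = gam ^+ n.+1 * (F u + theta - 2 * l%:~R * L) -> T u = w.
Proof.
move=> hw hm; apply/rowP => i; have [->|[j ->]] := ord_max_or_widen i.
  by rewrite T_max.
by rewrite T_widen.
Qed.

(** Chosen so that [d < onto_radius * e] means [(n.+2%:R * M + 1) * d < e / (2 * n.+2%:R)]: the
    error in the last coordinate is then within reach of a move of [e / (2 * n.+2%:R)] in the first
    one. *)
Definition onto_radius : R := (2 * n.+2%:R * (n.+2%:R * M + 1))^-1.

Lemma onto_radius_gt0 : 0 < onto_radius.
Proof.
have M0 : 0 < M by exact: lt_le_trans M1.
by rewrite invr_gt0 !mulr_gt0// addr_gt0// mulr_gt0.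
Qed.

Lemma T_locally_onto u e w : 0 < e -> eball u e `<=` W ->
  eucl_dist w (T u) < onto_radius * e -> exists2 v, eucl_dist u v < e & T v = w.
Proof.
move=> e0 uW; set d := eucl_dist w (T u) => dlt.
have M0 : 0 < M by exact: lt_le_trans M1.
have g1 := gam_lt1; have d0 : 0 <= d by exact: eucl_dist_ge0.
have k0 : 0 < n.+2%:R :> R by [].
pose a := e / (2 * n.+2%:R).
have a0 : 0 < a by rewrite divr_gt0// mulr_gt0.
have kM : 0 < n.+2%:R * M by rewrite mulr_gt0.
have da : (n.+2%:R * M + 1) * d < a.
  rewrite mulrC -ltr_pdivlMr ?addr_gt0//; apply: lt_le_trans dlt _.
  rewrite le_eqVlt; apply/orP; left; apply/eqP; rewrite /a /onto_radius.
  by move: (n.+2%:R : R) k0 kM => K *; field; rewrite !gt_eqF// addr_gt0.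
have da' : d <= a.
  by apply/ltW/(le_lt_trans _ da); rewrite ler_peMl// lerDr ltW.
pose x := u 0 ord0.
(* All coordinates of the preimage but the first are forced by [w]; the first one is the unknown
   [t]. *)
pose v t : 'rV[R]_n.+2 := insert_coord ord0 t (\row_j (gam * w 0 (wid j))).
have v0 t : v t 0 ord0 = t by rewrite mxE unlift_none.
have vl t j : v t 0 (lift ord0 j) = gam * w 0 (wid j) by rewrite !mxE liftK mxE.
have vd t j : `|u 0 (lift ord0 j) - v t 0 (lift ord0 j)| <= d.
  have -> : u 0 (lift ord0 j) - v t 0 (lift ord0 j) = gam * (T u 0 (wid j) - w 0 (wid j)).
    by rewrite vl T_widen; field; exact: lt0r_neq0.
  rewrite normrM gtr0_norm//; apply: (@le_trans _ _ (1 * `|T u 0 (wid j) - w 0 (wid j)|)).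
    by rewrite ler_wpM2r// ltW.
  by rewrite mul1r distrC coord_le_dist.
have vu t : `|t - x| <= a -> eucl_dist u (v t) < e.
  move=> ta; apply: (@le_lt_trans _ _ (n.+2%:R * a)).
    apply: eucl_dist_le_coord => [|i]; first exact: ltW.
    case: (unliftP ord0 i) => [j ->|->]; last by rewrite v0 distrC.
    exact: le_trans (vd t j) da'.
  rewrite (_ : _ * a = e / 2); last first.
    by rewrite /a; move: (n.+2%:R : R) k0 => K *; field; rewrite gt_eqF.
  by rewrite ltr_pdivrMr// mulrDr mulr1 ltrDl.
have vW t : `|t - x| <= a -> W (v t) by move=> /vu; exact: uW.
pose Q t := T (v t) 0 ord_max.
have QB s t : Q s - Q t = gam ^+ n.+1 * (F (v s) - F (v t)).
  by rewrite /Q !T_max; ring.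
have gn1 : gam ^+ n.+1 <= 1 by apply: exprn_ile1; exact: ltW.
have gn0 : 0 < gam ^+ n.+1 by rewrite exprn_gt0.
(* On this line the images differ only in the last coordinate, so the expansion estimate makes [Q]
   increase distances. *)
have Qlow s t : `|s - x| <= a -> `|t - x| <= a -> `|s - t| <= `|Q s - Q t|.
  move=> hs ht.
  have E : eucl_dist (T (v s)) (T (v t)) = `|Q s - Q t|.
    apply/eqP; rewrite -(eqrXn2 (n := 2))// ?eucl_dist_ge0//; apply/eqP.
    rewrite sqr_dist_T big1 ?mulr0 ?add0r ?QB; last first.
      by move=> j _; rewrite !vl subrr expr0n.
    by rewrite real_normK// num_real.
  have := T_expanding (W_sub_D (vW s hs)) (W_sub_D (vW t ht)); rewrite E.
  have h1 := coord_le_dist (v s) (v t) ord0; rewrite !v0 in h1.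
  move=> h2; apply: (le_trans h1); apply: (le_trans h2); rewrite ler_piMl//.
  rewrite invf_le1 ?sqrtr_gt0// -[leLHS]sqrtr1 ler_sqrt ltW//.
have Qup p q h : W p -> W q -> (forall i, `|p 0 i - q 0 i| <= h) -> 0 <= h ->
    `|T p 0 ord_max - T q 0 ord_max| <= n.+2%:R * M * h.
  move=> Wp Wq hpq h0; rewrite !T_max.
  rewrite (_ : _ - _ = gam ^+ n.+1 * (F p - F q)); last by ring.
  rewrite normrM (gtr0_norm gn0); apply: le_trans (F_lipschitz Wp Wq hpq).
  by rewrite ler_piMl.
have Qcont : {within `[x - a, x + a], continuous Q}.
  apply/subspace_continuousP => s; rewrite /= in_itv/= -ler_distlC distrC => hs.
  apply/cvgrPdist_lt => r r0; apply/nbhs_ballP.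
  exists (r / (n.+2%:R * M)) => /=; first by rewrite divr_gt0.
  move=> t; rewrite /ball/= => st; rewrite in_itv/= -ler_distlC distrC => ht.
  apply: (@le_lt_trans _ _ (n.+2%:R * M * `|s - t|)); last by rewrite mulrC -ltr_pdivlMr.
  apply: Qup => //; [exact: vW|exact: vW|] => i.
  by case: (unliftP ord0 i) => [j ->|->]; rewrite ?v0// !vl subrr normr0.
have Qinj : {in `[x - a, x + a] &, injective Q}.
  move=> s t; rewrite !in_itv/= -!ler_distlC => hs ht E.
  have := Qlow s t; rewrite E subrr normr0 ![`|_ - x|]distrC => /(_ hs ht).
  by rewrite normr_le0 subr_eq0 => /eqP.
have xx : `|x - x| <= a by rewrite subrr normr0 ltW.
have xp : `|x + a - x| <= a by rewrite addrC addKr gtr0_norm.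
have xm : `|x - a - x| <= a by rewrite addrC addKr normrN gtr0_norm.
(* Forcing the other coordinates of [u] changes the last coordinate of the image by at most
   [n.+2%:R * M * d], and [w] is [d] away from [T u]. *)
have Qx : `|Q x - w 0 ord_max| <= a.
  apply: le_trans (ltW da); rewrite mulrDl mul1r.
  apply: (le_trans (ler_distD (T u 0 ord_max) _ _)); apply: lerD.
    apply: Qup => //; first exact: vW.
      by apply: uW; rewrite /eball/= eucl_distxx.
    move=> i; case: (unliftP ord0 i) => [j ->|->]; first by rewrite distrC.
    by rewrite v0 subrr normr0.
  by rewrite distrC coord_le_dist.
have [c cin cw] : exists2 c, c \in `[x - a, x + a] & Q c = w 0 ord_max.
  have xap : x - a <= x + a by lra.
  have Ix : x \in `[x - a, x + a] by rewrite in_itv/=; apply/andP; split; lra.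
  have Ip : x + a \in `[x - a, x + a] by rewrite in_itv/=; apply/andP; split; lra.
  have Im : x - a \in `[x - a, x + a] by rewrite in_itv/=; apply/andP; split; lra.
  have hp : a <= `|Q (x + a) - Q x|.
    by apply: le_trans (Qlow _ _ xp xx); rewrite addrC addKr ler_norm.
  have hm : a <= `|Q x - Q (x - a)|.
    by apply: le_trans (Qlow _ _ xx xm); rewrite opprB addrC subrK ler_norm.
  move: Qx; rewrite ler_norml => /andP[q1 q2].
  (* [Q] is monotone and moves by at least [a] on either side of [x], so its values at the two ends
     enclose the target. *)
  apply: IVT => //; case: (itv_continuous_inj_mono Qcont Qinj) => mono.
    have : Q x <= Q (x + a) by apply/ltW/mono => //; rewrite ltrDl.
    have : Q (x - a) <= Q x by apply/ltW/mono => //; rewrite gtrBl.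
    move=> m1 m2; rewrite ger0_norm ?subr_ge0// in hp; rewrite ger0_norm ?subr_ge0// in hm.
    by rewrite ge_min le_max; apply/andP; split; apply/orP; [left|right]; lra.
  have : Q (x + a) <= Q x by apply/ltW/mono => //; rewrite ltrDl.
  have : Q x <= Q (x - a) by apply/ltW/mono => //; rewrite gtrBl.
  move=> m1 m2; rewrite ler0_norm ?subr_le0// in hp; rewrite ler0_norm ?subr_le0// in hm.
  by rewrite ge_min le_max; apply/andP; split; apply/orP; [right|left]; lra.
exists (v c).
  by apply: vu; move: cin; rewrite in_itv/= -ler_distlC distrC.
apply: row_eq_T => [j|].
  by rewrite vl; field; exact: lt0r_neq0.
by rewrite -cw /Q T_max.
Qed.

(* The entry [d_i g_m] of the Jacobian matrix of the inverse branch [g], as a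
   function of the preimage point: for [m = j + 1] it comes from
   [g_{j+1} w = gam w_j], for [m = 0] from differentiating
   [gam^(n+1) (F (g w) + theta - 2 l L) = w_{n+1}]. *)
Definition inv_pd (m i : 'I_n.+2) (u : 'rV[R]_n.+2) : R :=
  if unlift ord0 m is Some j then gam * (i == wid j)%:R
  else ((i == ord_max)%:R * gam ^- n.+1
        - \sum_(j < n.+1) gam * (i == wid j)%:R * F1 (lift ord0 j) u) * (F1 ord0 u)^-1.

Lemma C1_on_inv_pd m i : C1_on D (inv_pd m i).
Proof.
rewrite /inv_pd; case: (unlift ord0 m) => [j|]; first exact: C1_on_cst.
apply: C1_onM; last by apply: C1_onV (C1_on_F1 ord0) => x; exact: F1_0_neq0.
under eq_fun do rewrite -mulN1r mulr_sumr.
apply: C1_onD; first exact: C1_on_cst.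
apply: C1_on_sum => j; apply: C1_onM; first exact: C1_on_cst.
by apply: C1_onM; [exact: C1_on_cst|exact: C1_on_F1].
Qed.

(** The only nonzero entry of the last column is in the first row, and its minor matrix is [gam]
    times the identity; the powers of [gam] cancel. *)
Lemma det_inv_pd u : D u ->
  \det (\matrix_(m < n.+2, i < n.+2) inv_pd m i u) = (-1) ^+ n.+1 / F1 ord0 u.
Proof.
move=> Du; rewrite (expand_det_col _ ord_max) big_ord_recl/= big1 => [|j _]; last first.
  rewrite mxE /inv_pd liftK (_ : (_ == _) = false) ?mulr0 ?mul0r//.
  by apply/eqP => /(congr1 val)/= E; have := ltn_ord j; rewrite -E ltnn.
rewrite addr0 mxE /inv_pd unlift_none eqxx big1 => [|j _]; last first.
  rewrite (_ : (_ == _) = false) ?mulr0 ?mul0r//.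
  by apply/eqP => /(congr1 val)/= E; have := ltn_ord j; rewrite -E ltnn.
rewrite /cofactor (_ : row' _ _ = gam%:M); last first.
  apply/matrixP => a b; rewrite !mxE /inv_pd liftK -val_eqE/= /bump leqNgt ltn_ord add0n.
  by rewrite -[(b == a :> nat)]/(b == a) eq_sym; case: (a == b); rewrite ?mulr1 ?mulr0.
rewrite det_scalar add0n subr0 mul1r.
have := F1_0_neq0 Du; have : gam ^+ n.+1 != 0 by rewrite gt_eqF// exprn_gt0.
by move: (gam ^+ n.+1) (F1 ord0 u) => a b *; field; apply/andP.
Qed.

(** * Regularity and distortion of the inverse branches *)

Section Branch.
Variables (V : set 'rV[R]_n.+2) (g : 'rV[R]_n.+2 -> 'rV[R]_n.+2).
Hypotheses (oV : eopen V) (VW : V `<=` W) (gT : forall u, V u -> g (T u) = u).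
Notation O := (T @` V).

Lemma eopen_branch : eopen O.
Proof.
move=> _ [u Vu <-]; have [e e0 eV] := oV Vu.
exists (onto_radius * e); first by rewrite mulr_gt0// onto_radius_gt0.
move=> w; rewrite /eball/= eucl_distC => h.
have [|v uv <-] := T_locally_onto e0 _ h; first exact: subset_trans VW.
by exists v => //; exact: eV.
Qed.

Lemma Tg w : O w -> T (g w) = w.
Proof. by move=> [u Vu <-]; rewrite gT. Qed.

Lemma branch_D w : O w -> D (g w).
Proof. by move=> [u Vu <-]; rewrite gT//; apply/W_sub_D/VW. Qed.

Lemma branch_contracting x y : O x -> O y ->
  eucl_dist (g x) (g y) <= (Num.sqrt sigma)^-1 * eucl_dist x y.
Proof.
move=> Ox Oy; rewrite -{2}(Tg Ox) -{2}(Tg Oy).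
by apply: T_expanding; exact: branch_D.
Qed.

Lemma branch_lift w j : O w -> g w 0 (lift ord0 j) = gam * w 0 (wid j).
Proof.
by move=> Ow; rewrite -{2}(Tg Ow) T_widen mulrC divfK// gt_eqF.
Qed.

Lemma is_pd_branch m i w : O w -> is_pd i (coordfun g m) w (inv_pd m i (g w)).
Proof.
move=> Ow; rewrite /inv_pd; case: (unliftP ord0 m) => [j ->|->].
  have H := is_pd_coord i (wid j) gam w.
  rewrite eq_sym; apply: is_pd_congr eopen_branch Ow _ H => y Oy.
  by rewrite /coordfun branch_lift.
apply/is_pdP; pose c h := g (w + h *: evec R i).
have nO : \forall h \near (0 : R)^', O (w + h *: evec R i).
  exact: near_evec eopen_branch Ow.
have Dw := branch_D Ow.
have nD : \forall h \near (0 : R)^', D (c h).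
  by near=> h; apply: branch_D; near: h.
have nd : \forall h \near (0 : R)^', eucl_dist (g w) (c h) <= (Num.sqrt sigma)^-1 * `|h|.
  near=> h; rewrite -(eucl_dist_evec w i h); apply: branch_contracting => //.
  by near: h.
(* The first coordinate of [g] is only known to be Lipschitz so far. The mean value theorem is
   applied to [F] between [g w] and [c h], and the result is solved for the increment of that
   coordinate. *)
have /choice[xi Hxi] : forall h : R, exists xi : 'I_n.+2 -> 'rV[R]_n.+2, D (c h) ->
    (forall m, between (c h) (g w) (xi m)) /\
    F (c h) - F (g w) = \sum_m pd m F (xi m) * (c h 0 m - g w 0 m).
  move=> h; have [Dh|nDh] := pselect (D (c h)); last by exists (fun=> w).
  have [xi ? ?] := mvt_box (hull_closed_Omega_r gam0 (r := beta)) has_pd_F Dh Dw.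
  by exists xi.
have Dxi h m' : D (c h) -> D (xi h m').
  by move=> Dh; have [/(_ m') b _] := Hxi h Dh; exact: hull_closed_Omega_r b.
have cF1 m' : F1 m' (xi h m') @[h --> (0 : R)^'] --> F1 m' (g w).
  apply: (@cvg_econt _ _ D _ _ (fun h => xi h m') (Num.sqrt sigma)^-1) => //.
  - exact: econt_F1.
  - by near=> h; apply: Dxi; near: h.
  - near=> h; have Dh : D (c h) by near: h.
    have [/(_ m') b _] := Hxi h Dh; apply: (le_trans (dist_between b)).
    by near: h.
(* Near 0 the difference quotient equals the left-hand expression, whose intermediate points tend to
   [g w]. *)
have : ((i == ord_max)%:R * gam ^- n.+1
        - \sum_(j < n.+1) gam * (i == wid j)%:R * F1 (lift ord0 j) (xi h (lift ord0 j)))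
       * (F1 ord0 (xi h ord0))^-1 @[h --> (0 : R)^'] -->
       ((i == ord_max)%:R * gam ^- n.+1
        - \sum_(j < n.+1) gam * (i == wid j)%:R * F1 (lift ord0 j) (g w)) * (F1 ord0 (g w))^-1.
  apply: cvgM; last by apply: cvgV => //; exact: F1_0_neq0.
  apply: cvgB; first exact: cvg_cst.
  apply: cvg_sum_dnbhs => j; apply: cvgM; first exact: cvg_cst.
  exact: cF1.
apply: cvg_trans; apply: near_eq_cvg; near=> h.
have h0 : h != 0 by near: h; exact: nbhs_dnbhs_neq.
have Oh : O (w + h *: evec R i) by near: h.
have Dh : D (c h) by near: h.
have [_] := Hxi h Dh; rewrite big_ord_recl/= pd_F; last exact: Dxi.
rewrite (eq_bigr (fun j => h * (gam * (i == wid j)%:R * F1 (lift ord0 j) (xi h (lift ord0 j))))); last first.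
  move=> j _; rewrite pd_F; last exact: Dxi.
  rewrite /c !branch_lift// !mxE eqxx/= [wid j == i]eq_sym; ring.
rewrite -mulr_sumr; set s := \sum_(j < n.+1) _.
have gn : gam ^+ n.+1 != 0 by rewrite gt_eqF// exprn_gt0.
(* As [T] undoes [g] on [O], the increment of [F] along [c] is read off the last coordinate and is
   linear in [h]. *)
have -> : F (c h) - F (g w) = h * (i == ord_max)%:R / gam ^+ n.+1.
  apply/(canRL (mulfK gn)).
  have := congr1 (fun z : 'rV[R]_n.+2 => z 0 ord_max) (Tg Oh).
  have := congr1 (fun z : 'rV[R]_n.+2 => z 0 ord_max) (Tg Ow).
  rewrite /= !T_max !mxE eqxx/= [ord_max == i]eq_sym -/(c h) => h1 h2.
  have : gam ^+ n.+1 * (F (c h) + theta - 2 * l%:~R * L) -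
         gam ^+ n.+1 * (F (g w) + theta - 2 * l%:~R * L) = h * (i == ord_max)%:R.
    by rewrite h1 h2; ring.
  by move=> <-; ring.
have a0 := F1_0_neq0 (Dxi h ord0 Dh).
rewrite /coordfun -/(c h); set dl := c h 0 ord0 - g w 0 ord0.
move: gn a0; move: (F1 ord0 _) (gam ^+ n.+1) => a b b0 a0 E.
have -> : dl = (h * (i == ord_max)%:R / b - h * s) / a.
  by rewrite E addrK mulrC mulKf.
by field; rewrite b0 a0 h0.
Unshelve. all: by end_near. Qed.

Lemma C2_on_branch : C2_on O g.
Proof.
apply: (@C2_on_autonomous _ _ D O g inv_pd (Num.sqrt sigma)^-1).
- by rewrite invr_gt0 sqrtr_gt0.
- exact: hull_closed_Omega_r.
- exact: eopen_branch.
- exact: branch_D.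
- exact: branch_contracting.
- exact: C1_on_inv_pd.
- exact: is_pd_branch.
Qed.

Lemma jac_branch w : O w -> jac g w = (-1) ^+ n.+1 / F1 ord0 (g w).
Proof.
move=> Ow; rewrite -det_inv_pd; last exact: branch_D.
congr (\det _); apply/matrixP => a b; rewrite !mxE.
exact: is_pd_val (is_pd_branch _ _ Ow).
Qed.

(** Where [F1 ord0] is at least 1 in modulus, taking reciprocals does not increase differences. The
    factor 2 bounds the distance of [x] and [y] by [2 * eps], [n.+2%:R * M] is the Lipschitz
    constant of [F1 ord0], and the second [M] makes the bound relative to the Jacobian at [z]. *)
Lemma branch_distortion eps x y z : O x -> O y -> O z ->
  eball z eps x -> eball z eps y ->
  `|jac g x - jac g y| <= 2 * n.+2%:R * M ^+ 2 * `|jac g z| * eps.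
Proof.
move=> Ox Oy Oz zx zy; rewrite !jac_branch// -mulrBr !normrM normrX normrN1 expr1n !mul1r.
have Wg w : O w -> W (g w) by move=> [u Vu <-]; rewrite gT//; exact: VW.
have M0 : 0 < M by exact: lt_le_trans M1.
have ax := F1_0_ge1 (branch_D Ox); have ay := F1_0_ge1 (branch_D Oy).
have x0 := F1_0_neq0 (branch_D Ox); have y0 := F1_0_neq0 (branch_D Oy).
have z0 := F1_0_neq0 (branch_D Oz).
have xy : eucl_dist x y <= 2 * eps.
  have := eucl_dist_triangle z x y; rewrite (eucl_distC x z).
  move: zx zy; rewrite /eball/=; lra.
have gxy i : `|g x 0 i - g y 0 i| <= 2 * eps.
  apply: (le_trans (coord_le_dist _ _ _)); apply: (le_trans (branch_contracting Ox Oy)).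
  apply: le_trans xy; rewrite ler_piMl ?eucl_dist_ge0//.
  by rewrite invf_le1 ?sqrtr_gt0// -[leLHS]sqrtr1 ler_sqrt ltW.
have lip := F1_0_lipschitz (Wg _ Ox) (Wg _ Oy) gxy.
have h1 : `|(F1 ord0 (g x))^-1 - (F1 ord0 (g y))^-1| <= `|F1 ord0 (g x) - F1 ord0 (g y)|.
  have -> : (F1 ord0 (g x))^-1 - (F1 ord0 (g y))^-1 =
      - ((F1 ord0 (g x) - F1 ord0 (g y)) / (F1 ord0 (g x) * F1 ord0 (g y))).
    by field; rewrite x0 y0.
  rewrite normrN normrM normfV ler_pdivrMr; last by rewrite normr_gt0 (mulf_neq0 x0 y0).
  by rewrite ler_peMr// normrM mulr_ege1.
have h2 : 1 <= M * `|(F1 ord0 (g z))^-1|.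
  by rewrite normfV ler_pdivlMr ?normr_gt0// mul1r bound_F1//; exact: Wg.
apply: (le_trans h1); apply: (le_trans lip).
have e0 : 0 <= eps by apply: le_trans (ltW zx); exact: eucl_dist_ge0.
have c0 : 0 <= n.+2%:R * M * (2 * eps) by rewrite !mulr_ge0// ltW.
have := ler_wpM2l c0 h2; rewrite mulr1 => h3; apply: (le_trans h3).
by rewrite le_eqVlt; apply/orP; left; apply/eqP; ring.
Qed.

End Branch.

Lemma left_inverse_exists V : V `<=` D -> exists g, forall u, V u -> g (T u) = u.
Proof.
move=> VD; pose P w v := (exists2 u, V u & T u = w) -> V v /\ T v = w.
have /choice[g Hg] : forall w, exists v, P w v.
  move=> w; have [[u Vu Tu]|N] := pselect (exists2 u, V u & T u = w).
    by exists u.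
  by exists w => H; case: (N H).
exists g => u Vu; have [Vg Tgu] := Hg (T u) (ex_intro2 _ _ u Vu erefl).
by apply: T_inj => //; exact: VD.
Qed.

End Map.

(** * The domains [U_j]: neighbourhoods, finiteness, full measure *)

Section Partition.
Variable theta : R.
Notation U := (Uj gam L Phi0 theta).
Notation T := (Tj gam L Phi0 theta).
Notation rate := ((Num.sqrt sigma)^-1).

Lemma rate_gt0 : 0 < rate.
Proof. by rewrite invr_gt0 sqrtr_gt0. Qed.

Lemma rate_lt1 : rate < 1.
Proof.
rewrite invf_lt1 ?sqrtr_gt0// -[ltLHS]sqrtr1 ltr_sqrt//.
Qed.

(** From [Omega_r gam L 0] to [W] the faces in direction [i] move by [gam ^+ i * (beta / 2)]; this
    value is below all of these, so [V_j] stays inside [W]. *)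
Definition eps_m : R := gam ^+ n.+2 * (beta / 2).

Lemma eps_m_gt0 : 0 < eps_m.
Proof. by rewrite mulr_gt0 ?exprn_gt0// divr_gt0. Qed.

Notation V := (fun j => nbhd_set eps_m (U j)).

Lemma UjP j u : U j u <-> Omega_r gam L 0 u /\
  (2 * j%:~R - 1) * L < theta + F u < (2 * j%:~R + 1) * L.
Proof. by rewrite /Uj/= intrB intrD intrM. Qed.

Lemma eball_U_sub_W j u : U j u -> eball u eps_m `<=` W.
Proof.
move=> [U0 _]; apply: (eball_Omega_r gam0 gam_lt1 U0); first by rewrite subr0.
by rewrite divr_ge0// ltW.
Qed.

Lemma U_sub_W j : U j `<=` W.
Proof.
move=> u Uu; apply: (eball_U_sub_W Uu); rewrite /eball/= eucl_distxx.
exact: eps_m_gt0.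
Qed.

Lemma V_sub_W j : V j `<=` W.
Proof.
move=> x /nbhd_setP[u Uu xu]; apply: (eball_U_sub_W Uu).
by rewrite /eball/= eucl_distC.
Qed.

Lemma U_sub_Omega j : U j `<=` Omega gam L.
Proof.
move=> u [/(Omega_rP gam0) H _]; apply/(OmegaP gam0) => i.
by have := H i; rewrite addr0 => /ltW.
Qed.

Lemma Omega_sub_W : Omega gam L `<=` W.
Proof.
move=> u /(OmegaP gam0) H; apply/(Omega_rP gam0) => i.
apply: (le_lt_trans (H i)); rewrite ltr_pM2l ?exprn_gt0// ltrDl.
by rewrite divr_gt0.
Qed.

Lemma eopen_U j : eopen (U j).
Proof.
move=> u Uu; have [U0 /andP[lo hi]] := (UjP j u).1 Uu.
have [r1 r10 H1] := eopen_Omega_r gam0 U0.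
pose e := Num.min (theta + F u - (2 * j%:~R - 1) * L) ((2 * j%:~R + 1) * L - (theta + F u)).
have e0 : 0 < e by rewrite lt_min !subr_gt0 lo hi.
have e1 : e <= theta + F u - (2 * j%:~R - 1) * L by rewrite ge_min lexx.
have e2 : e <= (2 * j%:~R + 1) * L - (theta + F u) by rewrite ge_min lexx orbT.
have [d d0 Hd] := econt_F (W_sub_D (U_sub_W Uu)) e0.
exists (Num.min r1 d) => [|y]; first by rewrite lt_min r10.
rewrite /eball/= lt_min => /andP[y1 y2].
have y0 : Omega_r gam L 0 y by exact: H1.
have yD : D y.
  apply: W_sub_D; apply: Omega_sub_W; apply/(OmegaP gam0) => i.
  by have := (Omega_rP gam0 L 0 y).1 y0 i; rewrite addr0 => /ltW.
apply/UjP; split=> //; have := Hd y yD y2; rewrite ltr_norml => /andP[h1 h2].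
by apply/andP; split; lra.
Qed.

(** [F] is bounded on [Omega], being Lipschitz there, so [theta + F] meets only finitely many
    windows of length [2 * L]. *)
Lemma finite_J : finite_set [set j : int | U j !=set0].
Proof.
have W0 : W (0 : 'rV[R]_n.+2).
  apply: Omega_sub_W; apply/(OmegaP gam0) => i; rewrite mxE normr0.
  by rewrite mulr_ge0 ?exprn_ge0// ltW.
have M0 : 0 < M by exact: lt_le_trans M1.
pose B := `|theta| + (`|F 0| + n.+2%:R * M * L) + L.
have UB j : U j !=set0 -> `|j%:~R : R| <= B / L.
  move=> [u Uu]; have [_ /andP[lo hi]] := (UjP j u).1 Uu.
  have hu i : `|u 0 i - (0 : 'rV[R]_n.+2) 0 i| <= L.
    rewrite mxE subr0; apply: (le_trans ((OmegaP gam0 L u).1 (U_sub_Omega Uu) i)).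
    by rewrite ler_piMl ?(ltW L0)// exprn_ile1// ltW// gam_lt1.
  have hF := F_lipschitz (U_sub_W Uu) W0 hu.
  rewrite ler_pdivlMr// -{1}(gtr0_norm L0) -normrM.
  have h0 := ler_norm (F 0); have h0' := lerNnormlW (lexx `|F 0|).
  move: hF; rewrite ler_norml => /andP[h1 h2].
  have h3 := ler_norm theta; have h4 := lerNnormlW (lexx `|theta|).
  have kML : 0 <= n.+2%:R * M * L by rewrite !mulr_ge0// ltW.
  by rewrite /B ler_norml; apply/andP; split; lra.
pose N := (Num.truncn (B / L)).+1.
apply: sub_finite_set (finite_int_ball N) => j /UB jB /=.
have : `|j%:~R : R| < N%:R by exact: le_lt_trans jB (truncnS_gt _).
by rewrite -[N%:R]/(N%:Z%:~R) -intr_norm ltr_int.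
Qed.

Lemma Ttheta_U j u : U j u -> Ttheta gam L Phi0 theta u = T j u.
Proof.
move=> Uu; have [_ /andP[lo hi]] := (UjP j u).1 Uu.
apply/esym/row_eq_T => [i|].
  by rewrite mxE/= ltnS ltn_ord coordE.
rewrite mxE/= ltnn /redmod -/(F u).
have -> : Num.floor ((F u + theta + L) / (2 * L)) = j.
  have L2 : 0 < 2 * L by rewrite mulr_gt0.
  apply: floor_def; rewrite intrD ler_pdivlMr// ltr_pdivrMr//.
  by apply/andP; split; lra.
ring.
Qed.

Lemma Ttheta_U_nbhd j :
  nbhd_set (onto_radius * eps_m) (Ttheta gam L Phi0 theta @` U j) `<=` T j @` V j.
Proof.
move=> w /nbhd_setP[_ [u Uu <-]]; rewrite (Ttheta_U Uu) => wd.
have [v uv <-] := T_locally_onto eps_m_gt0 (eball_U_sub_W Uu) wd.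
by exists v => //; apply/nbhd_setP; exists u => //; rewrite eucl_distC.
Qed.

Lemma C2_on_T j : C2_on (V j) (T j).
Proof.
have oV : eopen (V j) by exact: eopen_nbhd_set.
have VD : V j `<=` D by move=> x /V_sub_W/W_sub_D.
move=> m; have [->|[i ->]] := ord_max_or_widen m.
  have -> : coordfun (T j) ord_max =
      (fun u => gam ^+ n.+1 * F u + gam ^+ n.+1 * (theta - 2 * j%:~R * L)).
    by apply/funext => u; rewrite /coordfun T_max; ring.
  apply: (@C2_scal_intro _ _ _ _ (fun i u => gam ^+ n.+1 * F1 i u)
    (fun i i' u => gam ^+ n.+1 * F2 i i' u)) => //.
  - apply: econt_onD; last exact: econt_on_cst.
    by apply: econt_onM; [exact: econt_on_cst|exact: econt_on_sub VD econt_F].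
  - by move=> i x /VD Dx; apply: is_pd_affine; exact: is_pd_F.
  - by move=> i; apply: econt_onM; [exact: econt_on_cst|exact: econt_on_sub VD (econt_F1 i)].
  - move=> i i' x /VD Dx; have := is_pd_affine (gam ^+ n.+1) 0 (is_pd_F1 i i' Dx).
    by under eq_fun do rewrite addr0.
  - move=> i i'; apply: econt_onM; first exact: econt_on_cst.
    exact: econt_on_sub VD (econt_F2 i i').
have -> : coordfun (T j) (widen_ord (leqnSn n.+1) i) =
    (fun u => gam^-1 * u 0 (lift ord0 i)).
  by apply/funext => u; rewrite /coordfun T_widen mulrC.
apply: (@C2_scal_intro _ _ _ _ (fun i' u => gam^-1 * (lift ord0 i == i')%:R)
  (fun _ _ _ => 0)) => //.
- apply: econt_onM; first exact: econt_on_cst.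
  move=> x _ e e0; exists e => // y _ xy; rewrite distrC.
  exact: le_lt_trans (coord_le_dist _ _ _) xy.
- by move=> i' x _; exact: is_pd_coord.
- by move=> i'; exact: econt_on_cst.
- by move=> i' i'' x _; exact: is_derive_cst.
- by move=> i' i''; exact: econt_on_cst.
Qed.

Lemma U_disjoint j j' : j <> j' -> U j `&` U j' = set0.
Proof.
move=> jj'; rewrite predeqE => u; split=> // -[/UjP[_ /andP[a1 a2]] /UjP[_ /andP[b1 b2]]].
exfalso; apply: jj'; apply/eqP; rewrite eq_le -!ltzD1 -!(ltr_int R) !intrD.
by apply/andP; split; rewrite -(ltr_pM2r L0); lra.
Qed.

(** The expansion read backwards: nearly equal values of [F] and nearly equal remaining coordinates
    force nearly equal first coordinates. This is the oscillation hypothesis of the slab lemmas,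
    where the coefficient of [h] does not affect the resulting volume. *)
Lemma level_osc u v h b : D u -> D v ->
  (forall j, j != ord0 -> `|u 0 j - v 0 j| <= h) ->
  `|gam ^+ n.+1 * (F u - F v)| <= b ->
  u 0 ord0 - v 0 ord0 <= rate * b + rate * (n.+1%:R / gam) * h.
Proof.
move=> Du Dv H Hb.
have h0 : 0 <= h by apply: le_trans (H (lift ord0 ord0) isT).
have b0 : 0 <= b by apply: le_trans Hb.
have g0 : 0 <= n.+1%:R / gam * h by rewrite mulr_ge0// divr_ge0// ltW.
apply: (le_trans (ler_norm _)); apply: (le_trans (coord_le_dist _ _ _)).
(* Differences of images do not depend on the branch index, so index 0 is taken. *)
apply: (le_trans (T_expanding theta 0 Du Dv)).
rewrite -mulrA -mulrDr ler_wpM2l ?(ltW rate_gt0)//.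
rewrite -(ler_pXn2r (n := 2))// ?nnegrE ?eucl_dist_ge0 ?addr_ge0//.
rewrite sqr_dist_T.
have h1 : gam ^- 2 * \sum_(j < n.+1) (u 0 (lift ord0 j) - v 0 (lift ord0 j)) ^+ 2
    <= (n.+1%:R / gam * h) ^+ 2.
  rewrite (_ : (n.+1%:R / gam * h) ^+ 2 = gam ^- 2 * (n.+1%:R * n.+1%:R * h ^+ 2)); last first.
    by field; exact: lt0r_neq0.
  rewrite ler_wpM2l ?invr_ge0 ?exprn_ge0 ?(ltW gam0)//.
  apply: (@le_trans _ _ (\sum_(j < n.+1) h ^+ 2)).
    apply: ler_sum => j _; rewrite -[leLHS]real_normK ?num_real//.
    by rewrite lerXn2r ?nnegrE ?normr_ge0// H.
  rewrite sumr_const card_ord -[leLHS]mulr_natl -mulrA ler_peMl ?ler1n//.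
  by rewrite mulr_ge0// sqr_ge0.
have h2 : (gam ^+ n.+1 * (F u - F v)) ^+ 2 <= b ^+ 2.
  by rewrite -[leLHS]real_normK ?num_real// lerXn2r ?nnegrE ?normr_ge0.
have h3 : 0 <= b * (n.+1%:R / gam * h) by rewrite mulr_ge0.
rewrite sqrrD mulr2n; lra.
Qed.

Lemma Omega_bounded : (Omega gam L : set 'rV[R]_n.+2) `<=` eball 0 (n.+2%:R * L + 1).
Proof.
move=> u /(OmegaP gam0) H; rewrite /eball/=; apply: (@le_lt_trans _ _ (n.+2%:R * L)).
  apply: eucl_dist_le_coord => [|i]; first exact: ltW.
  rewrite mxE sub0r normrN; apply: (le_trans (H i)).
  by rewrite ler_piMl ?(ltW L0)// exprn_ile1// ltW// gam_lt1.
by rewrite ltrDl.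
Qed.

Lemma partition_full :
  leb_outer (Omega gam L `\` \bigcup_(j in [set j : int | U j !=set0]) U j) = 0%E.
Proof.
apply/eqP; rewrite eq_le leb_outer_ge0 andbT.
have r0 : 0 < n.+2%:R * L + 1 by rewrite addr_gt0// mulr_gt0.
pose face (p : 'I_n.+2 * bool) :=
  [set u : 'rV[R]_n.+2 | Omega gam L u /\ u 0 p.1 = (-1) ^+ p.2 * (gam ^+ p.1 * L)].
(* The integer [c] is coded by [pickle] so that the levels form a sequence indexed by natural
   numbers. *)
pose level m := [set u : 'rV[R]_n.+2 | Omega gam L u /\
  exists2 c : int, pickle c = m & theta + F u = (2 * c%:~R - 1) * L].
have face0 p : (leb_outer (face p) <= 0)%E.
  apply: (@leb_outer_null_graph _ _ p.1 _ _ 0 r0) => //.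
    by move=> u [/Omega_bounded].
  by move=> u v h [_ ->] [_ ->] _; rewrite subrr mul0r.
have level0 m : (leb_outer (level m) <= 0)%E.
  apply: (@leb_outer_null_graph _ _ ord0 _ _ (rate * (n.+1%:R / gam)) r0) => //.
  - by rewrite mulr_ge0 ?(ltW rate_gt0)// divr_ge0// ltW.
  - by move=> u [/Omega_bounded].
  move=> u v h [Ou [c cm Fu]] [Ov [c' cm' Fv]] H.
  have cc : c = c' by apply: (pcan_inj pickleK); rewrite cm cm'.
  have FF : F u = F v by apply: (addrI theta); rewrite Fu Fv cc.
  have := @level_osc u v h 0 (W_sub_D (Omega_sub_W Ou)) (W_sub_D (Omega_sub_W Ov)) H.
  by rewrite FF subrr !mulr0 normr0 add0r; apply.
apply: (@le_trans _ _ (leb_outer ([set u | exists2 p, p \in index_enum _ & face p u]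
    `|` \bigcup_m level m))).
  apply: le_leb_outer => u [Ou NU].
  have [[i Hi]|Nface] := pselect (exists i, `|u 0 i| = gam ^+ i * L).
    left; exists (i, u 0 i < 0); first by rewrite mem_index_enum.
    split=> //=; rewrite -Hi; case: ltP => h; last by rewrite expr0 mul1r ger0_norm.
    by rewrite expr1 mulN1r ltr0_norm// opprK.
  (* Off the faces, the point lies in [U_c] unless it sits on the lower level of that window, the
     one value that the floor allows and [U_c] excludes. *)
  right; pose c := Num.floor ((theta + F u + L) / (2 * L)).
  have L2 : 0 < 2 * L by rewrite mulr_gt0.
  have /andP[] := floor_itv ((theta + F u + L) / (2 * L)).
  rewrite -/c intrD ler_pdivlMr// ltr_pdivrMr// => c1 c2.
  have [E|NE] := eqVneq (theta + F u) ((2 * c%:~R - 1) * L).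
    by exists (pickle c) => //; split=> //; exists c.
  exfalso; apply: NU; have Uc : U c u.
    apply/UjP; split.
      apply/(Omega_rP gam0) => i; rewrite addr0 lt_neqAle (OmegaP gam0 L u).1// andbT.
      by apply/eqP => Hi; apply: Nface; exists i.
    by rewrite lt_neqAle eq_sym NE/=; apply/andP; split; lra.
  by exists c => //; exists u.
apply: (le_trans (leb_outer_setU _ _ _)) => //.
rewrite -[leRHS]adde0; apply: leeD.
  apply: (le_trans (leb_outer_bigU _ _ _)) => //.
  by apply: sume_le0 => p _; exact: face0.
exact: leb_outer_bigcup_null.
Qed.

Lemma U_closure_W j z : W z -> eclosure (U j) z ->
  (forall i, `|z 0 i| <= gam ^+ i * L) /\
  (2 * j%:~R - 1) * L <= theta + F z <= (2 * j%:~R + 1) * L.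
Proof.
move=> Wz cz; have M0 : 0 < M by exact: lt_le_trans M1.
split=> [i|].
  apply/ler_addgt0Pr => e e0; have [u Uu zu] := cz e e0.
  have := (OmegaP gam0 L u).1 (U_sub_Omega Uu) i.
  have := ler_norm_addB (u 0 i) (z 0 i); rewrite distrC.
  have := coord_le_dist z u i; lra.
have kM : 0 < n.+2%:R * M by rewrite mulr_gt0.
have H e : 0 < e -> (2 * j%:~R - 1) * L <= theta + F z + e /\
    theta + F z <= (2 * j%:~R + 1) * L + e.
  move=> e0; have [u Uu zu] := cz _ (divr_gt0 e0 kM).
  have [_ /andP[lo hi]] := (UjP j u).1 Uu.
  have := @F_lipschitz z u (e / (n.+2%:R * M)) Wz (U_sub_W Uu).
  rewrite [_ * (_ / (n.+2%:R * M))]mulrC divfK ?gt_eqF// ler_norml => /(_ _)/andP[|h1 h2].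
    by move=> i; apply: le_trans (coord_le_dist _ _ _) (ltW zu).
  by split; lra.
by apply/andP; split; apply/ler_addgt0Pr => e /H[].
Qed.

(** A boundary point of the image is within [onto_radius * eps_m] of it, hence equal to [T j z] with
    [z] in [V_j]. Contraction of the inverse puts [z] in the closure of [U_j], and openness of the
    image keeps it out of [U_j]. *)
Lemma image_boundary_point j eps u :
  nbhd_set eps (eboundary (T j @` U j)) (T j u) ->
  exists z, [/\ W z, ~ U j z, forall i, `|z 0 i| <= gam ^+ i * L,
    (2 * j%:~R - 1) * L <= theta + F z <= (2 * j%:~R + 1) * L
    & eucl_dist (T j u) (T j z) < eps].
Proof.
move=> /nbhd_setP[w [cw iw] uw].
have r0 : 0 < onto_radius * eps_m by rewrite mulr_gt0 ?onto_radius_gt0// eps_m_gt0.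
have [z Vz zw] : (T j @` V j) w.
  apply: Ttheta_U_nbhd; apply/nbhd_setP; have [_ [v Uv <-] wv] := cw _ r0.
  by exists (T j v) => //; exists v => //; exact: Ttheta_U.
have Wz := V_sub_W Vz.
have cz : eclosure (U j) z.
  move=> r rp; have [_ [v Uv <-] wv] := cw _ rp; exists v => //.
  apply: (le_lt_trans (T_expanding theta j (W_sub_D Wz) (W_sub_D (U_sub_W Uv)))).
  apply: le_lt_trans wv; rewrite zw ler_piMl ?eucl_dist_ge0//.
  exact/ltW/rate_lt1.
have [h1 h2] := U_closure_W Wz cz.
exists z; split=> //; last by rewrite zw.
move=> Uz; apply: iw.
have oT : eopen (T j @` U j) by apply: eopen_branch => //; [exact: eopen_U|exact: U_sub_W].
by apply: oT; exists z.
Qed.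

(** The first bound gives [eps / gam ^+ n.+1 <= L / 4] for [eps <= eps_0] and keeps opposite faces
    apart; the second makes [F] vary by at most [L / 4] on the balls of (PE5). *)
Definition eps_0 : R := Num.min (gam ^+ n.+1 * L / 4) (L / (8 * n.+2%:R * M)).

Lemma eps_0_gt0 : 0 < eps_0.
Proof.
have M0 : 0 < M by exact: lt_le_trans M1.
by rewrite lt_min !divr_gt0 ?mulr_gt0 ?exprn_gt0.
Qed.

(** * Counting slabs in a ball for (PE5) *)

Section Ball.
Variables (x : 'rV[R]_n.+2) (eps delta : R).
Hypotheses (eps0 : 0 < eps) (eps_delta : eps <= delta) (delta_eps0 : delta <= eps_0).
Notation rho := ((1 - rate) * delta).
Notation B := (eball x rho).
Notation ceps := (eps / gam ^+ n.+1).

Definition strip j := [set u | V j u /\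
  nbhd_set eps (eboundary (T j @` U j)) (T j u)] `&` B.

Lemma rho_gt0 : 0 < rho.
Proof. by rewrite mulr_gt0 ?subr_gt0 ?rate_lt1// (lt_le_trans eps0). Qed.

Lemma ceps_gt0 : 0 < ceps.
Proof. by rewrite divr_gt0// exprn_gt0. Qed.

Lemma ceps_le : ceps <= L / 4.
Proof.
rewrite ler_pdivrMr ?exprn_gt0//.
have : delta <= gam ^+ n.+1 * L / 4 by apply: le_trans delta_eps0 _; rewrite ge_min lexx.
by move=> h; apply: (le_trans eps_delta); rewrite mulrAC [L * _]mulrC.
Qed.

Lemma F_ball_osc u v : W u -> W v -> B u -> B v -> `|F u - F v| <= L / 4.
Proof.
move=> Wu Wv Bu Bv; have M0 : 0 < M by exact: lt_le_trans M1.
have d0 : 0 < delta by exact: lt_le_trans eps0 eps_delta.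
have rd : rho <= delta by rewrite ler_piMl ?(ltW d0)// gerBl ltW// rate_gt0.
have uv i : `|u 0 i - v 0 i| <= 2 * delta.
  have := coord_le_dist x u i; have := coord_le_dist x v i.
  move: Bu Bv; rewrite /eball/= => ? ? h1 h2.
  apply: (le_trans (ler_distD (x 0 i) _ _)); rewrite (distrC (u 0 i)); lra.
apply: (le_trans (F_lipschitz Wu Wv uv)).
have : delta <= L / (8 * n.+2%:R * M).
  by apply: le_trans delta_eps0 _; rewrite ge_min lexx orbT.
by rewrite ler_pdivlMr ?mulr_gt0//; lra.
Qed.

(** A distance below [eps] between images means less than [ceps] for [F], through the last
    coordinate, and less than [rate * eps] for each coordinate, through the expansion. *)
Lemma strip_point j u : strip j u ->
  exists z, [/\ W z, ~ U j z, forall i, `|z 0 i| <= gam ^+ i * L,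
    (2 * j%:~R - 1) * L <= theta + F z <= (2 * j%:~R + 1) * L
    & `|F u - F z| < ceps /\ forall i, `|u 0 i - z 0 i| < rate * eps].
Proof.
move=> [[Vu Nu] Bu]; have [z [Wz Uz z1 z2 uz]] := image_boundary_point Nu.
exists z; split=> //; split.
  rewrite ltr_pdivlMr ?exprn_gt0//.
  have := coord_le_dist (T j u) (T j z) ord_max; rewrite !T_max.
  rewrite (_ : _ - _ = (F u - F z) * gam ^+ n.+1); last by ring.
  rewrite normrM (gtr0_norm (exprn_gt0 n.+1 gam0)) => h.
  exact: le_lt_trans h uz.
move=> i; apply: (le_lt_trans (coord_le_dist _ _ _)).
apply: (le_lt_trans (T_expanding theta j (W_sub_D (V_sub_W Vu)) (W_sub_D Wz))).
by rewrite ltr_pM2l// rate_gt0.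
Qed.

(* The index of the only level [theta + F = (2 l - 1) L] that can come close to
   the ball (an arbitrary index if the ball misses [W]). *)
Definition center_level : int :=
  Num.floor ((if pselect (exists u, W u /\ B u) is left H
              then theta + F (projT1 (cid H)) else 0) / (2 * L)) + 1.
Notation l := center_level.

(** At the chosen point of the ball, [theta + F] lies in the window of length [2 * L] centred at
    [(2 * l - 1) * L], thanks to the [+ 1] in the index; the oscillation over the ball adds
    [L / 4]. *)
Lemma center_levelP u : W u -> B u ->
  (2 * l%:~R - 2) * L - L / 4 <= theta + F u < 2 * l%:~R * L + L / 4.
Proof.
move=> Wu Bu; rewrite /l intrD.
case: pselect => [H|N]; last by exfalso; apply: N; exists u.
case: (cid H) => v [Wv Bv] /=.
have L2 : 0 < 2 * L by rewrite mulr_gt0.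
have /andP[] := floor_itv ((theta + F v) / (2 * L)).
rewrite intrD ler_pdivlMr// ltr_pdivrMr//.
move: (Num.floor _) => c h1 h2.
have := F_ball_osc Wu Wv Bu Bv; rewrite ler_norml => /andP[h3 h4].
by apply/andP; split; lra.
Qed.

(** The errors [L / 4] from the ball and from [ceps] sum to less than [L], which leaves only the two
    windows adjacent to level [l]. *)
Lemma strip_level j u : strip j u -> j = l \/ j = l - 1.
Proof.
move=> Su; have [z [_ _ _ /andP[z1 z2] [uz _]]] := strip_point Su.
have [[Vu _] Bu] := Su; have /andP[u1 u2] := center_levelP (V_sub_W Vu) Bu.
have ce := ceps_le; move: uz; rewrite ltr_norml => /andP[h1 h2].
have j1 : j < l + 1.
  by rewrite -(ltr_int R) intrD -(ltr_pM2r L0); lra.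
have j2 : l < j + 2.
  by rewrite -(ltr_int R) intrD -(ltr_pM2r L0); lra.
exact: int_eq_or_pred.
Qed.

Notation lev := ((2 * l%:~R - 1) * L).
Definition level_slab := [set u : 'rV[R]_n.+2 | [/\ W u, B u & `|theta + F u - lev| < ceps]].
Definition face_slab (i : 'I_n.+2) :=
  [set u : 'rV[R]_n.+2 | [/\ W u, B u & `| `|u 0 i| - gam ^+ i * L| < rate * eps]].
Definition above := [set u : 'rV[R]_n.+2 | lev + ceps <= theta + F u].
Definition below := [set u : 'rV[R]_n.+2 | theta + F u <= lev - ceps].

(** As [z] satisfies the weak inequalities of [U_j] but is not in it, one of them is an equality.
    Level [l] is excluded because [u] is outside [level_slab], and the other level is too far from
    the ball, so [z] is on a face. *)
Lemma strip_face j u : strip j u -> ~ level_slab u ->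
  exists2 i, i \in index_enum 'I_n.+2 & face_slab i u.
Proof.
move=> Su Nl; have [z [Wz Uz z1 /andP[z2 z3] [uz uzi]]] := strip_point Su.
have [[Vu _] Bu] := Su; have Wu := V_sub_W Vu.
have /andP[u1 u2] := center_levelP Wu Bu.
have ce := ceps_le; have c0 := ceps_gt0.
have jl := strip_level Su.
have zl : theta + F z != lev.
  apply/eqP => E; apply: Nl; split=> //.
  by rewrite -E opprD addrACA subrr add0r.
have uz' := uz; move: uz'; rewrite ltr_norml => /andP[h1 h2].
have [i Hi] : exists i, `|z 0 i| = gam ^+ i * L.
  apply: contrapT => N; apply: Uz; apply/UjP; split.
    apply/(Omega_rP gam0) => i; rewrite addr0 lt_neqAle z1 andbT.
    by apply/eqP => E; apply: N; exists i.
  case: jl => E; rewrite E ?intrB in z2 z3 *; apply/andP; split.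
  - by rewrite lt_neqAle eq_sym zl.
  - by lra.
  - by lra.
  - rewrite lt_neqAle; apply/andP; split; last by lra.
    by apply: contraNN zl => /eqP ->; apply/eqP; ring.
exists i; first exact: mem_index_enum.
split=> //; rewrite -Hi; apply: le_lt_trans (uzi i).
exact: ler_dist_dist.
Qed.

(** The window of branch [l] has level [l] as its lower end: [z] is on or above it and [F] changes
    by less than [ceps] from [z] to [u]. [strip_below] is the mirror image. *)
Lemma strip_above u : strip l u -> ~ level_slab u -> above u.
Proof.
move=> Su Nl; have [z [Wz Uz z1 /andP[z2 z3] [uz uzi]]] := strip_point Su.
have [[Vu _] Bu] := Su; have Wu := V_sub_W Vu.
rewrite /above/= leNgt; apply/negP => h; apply: Nl; split=> //.
move: uz; rewrite !ltr_norml => /andP[h1 h2].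
by apply/andP; split; lra.
Qed.

Lemma strip_below u : strip (l - 1) u -> ~ level_slab u -> below u.
Proof.
move=> Su Nl; have [z [Wz Uz z1 /andP[z2 z3] [uz uzi]]] := strip_point Su.
have [[Vu _] Bu] := Su; have Wu := V_sub_W Vu.
rewrite /below/= leNgt; apply/negP => h; apply: Nl; split=> //.
move: uz z2 z3; rewrite intrB !ltr_norml => /andP[h1 h2] z2 z3.
by apply/andP; split; lra.
Qed.

Notation c := (rho ^+ n.+1 * unit_ball_vol R n.+1).

Lemma leb_level_slab : (leb_outer level_slab <= (2 * rate * eps * c)%:E)%E.
Proof.
have rg := rate_gt0.
apply: (@leb_outer_slab_eball _ _ ord0 _ x _ _ (rate * (n.+1%:R / gam))).
- exact: rho_gt0.
- by rewrite !mulr_ge0// ltW.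
- by rewrite mulr_ge0 ?(ltW rg)// divr_ge0// ltW.
- by move=> u [].
move=> u v h [Wu Bu lu] [Wv Bv lv] H.
rewrite [2 * rate]mulrC -mulrA; apply: level_osc; [exact: W_sub_D|exact: W_sub_D|by []|].
have gn : 0 < gam ^+ n.+1 by rewrite exprn_gt0.
rewrite normrM (gtr0_norm gn) mulrC -ler_pdivlMr//.
have -> : F u - F v = (theta + F u - lev) - (theta + F v - lev) by ring.
apply: (le_trans (ler_normB _ _)); rewrite mulrAC -mulrA; move: lu lv; lra.
Qed.

Lemma leb_face_slab i : (leb_outer (face_slab i) <= (2 * rate * eps * c)%:E)%E.
Proof.
have rg := rate_gt0; have rl := rate_lt1.
have d0 : 0 < delta by exact: lt_le_trans eps0 eps_delta.
apply: (@leb_outer_slab_eball _ _ i _ x _ _ 0).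
- exact: rho_gt0.
- by rewrite !mulr_ge0// ltW.
- by [].
- by move=> u [].
move=> u v h [Wu Bu fu] [Wv Bv fv] _; rewrite mul0r addr0.
(* The ball cannot come close to both faces in direction [i]: such points would be more than
   [2 * (gam ^+ i * L - rate * eps)] apart, which exceeds the diameter [2 * rho]. *)
have dg : delta < gam ^+ i * L.
  have h1 : delta <= gam ^+ n.+1 * L / 4.
    by apply: le_trans delta_eps0 _; rewrite ge_min lexx.
  have h2 : gam ^+ n.+1 * L <= gam ^+ i * L.
    by rewrite ler_pM2r// gam_exp_le ?gam_lt1// -ltnS.
  have h3 : 0 < gam ^+ n.+1 * L by rewrite mulr_gt0// exprn_gt0.
  lra.
have re : rate * eps <= rate * delta by rewrite ler_pM2l.
have := coord_le_dist x u i; have := coord_le_dist x v i.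
move: Bu Bv; rewrite /eball/= => Bu Bv; rewrite !ler_norml => /andP[a1 a2] /andP[b1 b2].
move: fu fv; rewrite !ltr_norml => /andP[p1 p2] /andP[q1 q2].
case: (leP 0 (u 0 i)) => hu; case: (leP 0 (v 0 i)) => hv.
- rewrite (ger0_norm hu) in p1 p2; rewrite (ger0_norm hv) in q1 q2; lra.
- rewrite (ger0_norm hu) in p1 p2; rewrite (ltr0_norm hv) in q1 q2; lra.
- rewrite (ltr0_norm hu) in p1 p2; rewrite (ger0_norm hv) in q1 q2; lra.
- rewrite (ltr0_norm hu) in p1 p2; rewrite (ltr0_norm hv) in q1 q2; lra.
Qed.

(** Values of [F] on the two parts differ by at least [2 * ceps], so the Lipschitz bound separates
    them in some coordinate and [leb_outer_separated] applies inside the face slab. *)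
Lemma leb_face_split i :
  (leb_outer (face_slab i `&` above) + leb_outer (face_slab i `&` below)
     <= (2 * rate * eps * c)%:E)%E.
Proof.
have M0 : 0 < M by exact: lt_le_trans M1.
have kM : 0 < n.+2%:R * M by rewrite mulr_gt0.
have c0 := ceps_gt0.
apply: (@leb_outer_separated _ _ _ _ (ceps / (n.+2%:R * M))) => //.
- by rewrite divr_gt0.
- move=> u v [[Wu _ _] au] [[Wv _ _] bv]; apply: contrapT => N.
  have H i' : `|u 0 i' - v 0 i'| <= ceps / (n.+2%:R * M).
    by rewrite leNgt; apply/negP => h; apply: N; exists i'; exact: ltW.
  have := F_lipschitz Wu Wv H; rewrite [_ * (_ / (n.+2%:R * M))]mulrC divfK ?gt_eqF// ler_norml => /andP[h1 h2].
  by move: au bv; rewrite /above /below/=; lra.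
- apply: le_trans (leb_face_slab i); apply: le_leb_outer.
  by move=> u [[]|[]].
Qed.

Lemma leb_strip : (leb_outer (strip l) + leb_outer (strip (l - 1)) <=
  (n.+4%:R * (2 * rate * eps * c))%:E)%E.
Proof.
have half j H : (forall u, strip j u -> ~ level_slab u -> H u) ->
    (leb_outer (strip j) <= leb_outer level_slab +
      \sum_(i < n.+2) leb_outer (face_slab i `&` H))%E.
  move=> sH; apply: (@le_trans _ _ (leb_outer (level_slab `|`
      [set u | exists2 i, i \in index_enum 'I_n.+2 & (face_slab i `&` H) u]))).
    apply: le_leb_outer => u Su; have [lu|Nl] := pselect (level_slab u); first by left.
    right; have [i ii fi] := strip_face Su Nl; exists i => //; split=> //.
    exact: sH.
  apply: (le_trans (leb_outer_setU _ _ _)) => //.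
  apply: leeD => //; exact: leb_outer_bigU.
apply: (le_trans (leeD (half _ _ strip_above) (half _ _ strip_below))).
(* Regrouping pairs the two copies of the level slab and, for each face, the parts above and below,
   so [2 + n.+2] slabs are counted. *)
rewrite addeACA -big_split/=.
apply: (@le_trans _ _ (((2 * rate * eps * c)%:E + (2 * rate * eps * c)%:E) +
    \sum_(i < n.+2) (2 * rate * eps * c)%:E)%E).
  apply: leeD; first by apply: leeD; exact: leb_level_slab.
  by apply: lee_sum => i _; exact: leb_face_split.
rewrite sumEFin -!EFinD lee_fin sumr_const card_ord -[X in _ + X <= _]mulr_natl.
rewrite le_eqVlt; apply/orP; left; apply/eqP.
by rewrite -[n.+4%:R]natr1 -[n.+3%:R]natr1; ring.
Qed.

Lemma Gx_le : (Gx gam L Phi0 theta sigma eps_m x eps delta <=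
  (n.+4%:R * (2 * rate * eps) / rho *
    (unit_ball_vol R n.+1 / unit_ball_vol R n.+2))%:E)%E.
Proof.
have r0 := rho_gt0; have rn (m : nat) : 0 < rho ^+ m by rewrite exprn_gt0.
rewrite /Gx leb_outer_eball//=.
set q := (rho ^+ n.+2 * unit_ball_vol R n.+2)^-1.
have q0 : 0 <= q by rewrite invr_ge0 mulr_ge0 ?unit_ball_vol_ge0// ltW.
apply: (@le_trans _ _ (leb_outer (strip l) * q%:E + leb_outer (strip (l - 1)) * q%:E)%E).
  apply: (@esum_le_two _ _ _ (fun j => leb_outer (strip j) * q%:E)%E).
    by move=> j; rewrite mule_ge0 ?leb_outer_ge0.
  move=> j jl jl1; rewrite (_ : strip j = set0) ?leb_outer_set0 ?mul0e//.
  rewrite predeqE => u; split=> // /strip_level[] E.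
    by rewrite E eqxx in jl.
  by rewrite E eqxx in jl1.
rewrite -ge0_muleDl ?leb_outer_ge0//.
apply: (le_trans (lee_wpmul2r _ leb_strip)); first by rewrite lee_fin.
rewrite -EFinM lee_fin /q [rho ^+ n.+2]exprS le_eqVlt; apply/orP; left; apply/eqP.
have rn1 : rho ^+ n.+1 != 0 by rewrite gt_eqF.
move: (rho ^+ n.+1) rn1 (unit_ball_vol R n.+1) (unit_ball_vol R n.+2) => P P0 g1 g2.
move: (2 * rate * eps) (n.+4%:R : R) rho => a N r.
rewrite !invfM -[RHS]mulr1 -(divff P0); ring.
Qed.

End Ball.

(** The factor [delta / eps] cancels both radii, and [rate / (1 - rate) = 1 / (sqrt sigma - 1)]
    turns the bound of [Gx_le] into the second term of [eta0]. *)
Lemma eta_fn_le delta : 0 < delta -> delta <= eps_0 ->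
  (eta_fn gam L Phi0 theta sigma eps_m delta <= (eta0 n.+2 sigma (n.+2 + 2)%:R)%:E)%E.
Proof.
move=> d0 de; rewrite /eta_fn /eta0 [leRHS]EFinD; apply: leeD => //.
set A := 4 / _ * _ * _.
have -> : A%:E = (2%:E * (A / 2)%:E)%E.
  by rewrite -EFinM; congr EFin; field.
apply: lee_wpmul2l; first by rewrite lee_fin.
apply: ge_ereal_sup => _ [eps /= /andP[e0 ed] <-].
have rl := rate_lt1; have rg := rate_gt0.
have G0 : (Gsup gam L Phi0 theta sigma eps_m eps delta <=
  (n.+4%:R * (2 * rate * eps) / ((1 - rate) * delta) *
    (unit_ball_vol R n.+1 / unit_ball_vol R n.+2))%:E)%E.
  by apply: ge_ereal_sup => _ [x _ <-]; exact: Gx_le.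
apply: (le_trans (lee_wpmul2r _ G0)); first by rewrite lee_fin divr_ge0// ltW.
rewrite -EFinM lee_fin le_eqVlt; apply/orP; left; apply/eqP.
have sq : 1 < Num.sqrt sigma by rewrite -[ltLHS]sqrtr1 ltr_sqrt.
rewrite /A addn2 /=; move: (unit_ball_vol R n.+1 / unit_ball_vol R n.+2) => b.
move: (Num.sqrt sigma) sq (n.+4%:R : R) => a a1 N.
have h1 : a - 1 != 0 by rewrite subr_eq0 gt_eqF.
have h2 : a != 0 by rewrite gt_eqF// (lt_trans ltr01).
have h3 : 1 - a^-1 != 0 by rewrite subr_eq0 eq_sym invr_eq1 gt_eqF.
have -> : (1 - a^-1) = (a - 1) / a by field.
by field; rewrite h1 h2 !gt_eqF.
Qed.

Lemma partition_pre : let J := [set j : int | U j !=set0] in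
  finite_set J /\
  (forall j, J j ->
     [/\ eopen (U j), U j `<=` Omega gam L, eclosure (U j) `<=` V j,
         V j `<=` Omega_r gam L beta & C2_on (V j) (T j)]) /\
  (forall j j', J j -> J j' -> j <> j' -> U j `&` U j' = set0).
Proof.
split; first exact: finite_J.
split=> [j _|j j' _ _]; last exact: U_disjoint.
split.
- exact: eopen_U.
- exact: U_sub_Omega.
- exact: eclosure_nbhd_set eps_m_gt0.
- by move=> u /V_sub_W/W_sub_D.
- exact: C2_on_T.
Qed.

Lemma branch_properties j : [/\ {in V j &, injective (T j)}, eopen (T j @` V j)
  & exists g : 'rV[R]_n.+2 -> 'rV[R]_n.+2,
    [/\ forall u, V j u -> g (T j u) = u,
        C2_on (T j @` V j) g,
        (forall eps : R, 0 < eps < eps_0 ->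
           forall z, (T j @` V j) z ->
           forall x y, eball z eps x -> (T j @` V j) x ->
                       eball z eps y -> (T j @` V j) y ->
           `|jac g x - jac g y| <= 2 * n.+2%:R * M ^+ 2 * `|jac g z| * eps)
      & (forall u v, (T j @` V j) u -> (T j @` V j) v -> eucl_dist u v <= eps_0 ->
           eucl_dist (g u) (g v) <= rate * eucl_dist u v)]].
Proof.
have VD : V j `<=` D by move=> u /V_sub_W/W_sub_D.
have oV : eopen (V j) by exact: eopen_nbhd_set.
have VW := @V_sub_W j.
split.
- by move=> u v; rewrite !inE => /VD Du /VD Dv; exact: T_inj.
- exact: eopen_branch.
have [g gT] := left_inverse_exists theta j VD.
exists g; split; first exact: gT.
- exact: C2_on_branch.
- by move=> eps _ z Oz x y zx Ox zy Oy; exact: (branch_distortion oV VW gT Ox Oy Oz zx zy).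
- by move=> u v Ou Ov _; exact: (branch_contracting VW gT Ou Ov).
Qed.

Lemma eta_sup_lt1 : eta0 n.+2 sigma (n.+2 + 2)%:R < 1 ->
  (ereal_sup [set eta_fn gam L Phi0 theta sigma eps_m delta
             | delta in [set d : R | 0 < d <= eps_0]%R] < 1)%E.
Proof.
move=> e1; apply: (@le_lt_trans _ _ (eta0 n.+2 sigma (n.+2 + 2)%:R)%:E); last by rewrite lte_fin.
by apply: ge_ereal_sup => _ [d /= /andP[d0 de] <-]; exact: eta_fn_le.
Qed.

End Partition.

End ExpandingMap.

(** Turns [eta0 = 1] at [Sk] into a strict inequality at [sigma]; the strictness comes from the
    first term, the second being handled as weakly decreasing. *)
Lemma eta0_decreasing (R : realType) (k : nat) (s t Y : R) :
  1 < s -> s < t -> 0 <= Y -> eta0 k t Y < eta0 k s Y.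
Proof.
move=> s1 st Y0; have s0 : 0 < s by exact: lt_trans s1.
have t0 : 0 < t by exact: lt_trans st.
have q1 : 1 < Num.sqrt s by rewrite -[ltLHS]sqrtr1 ltr_sqrt.
have q2 : Num.sqrt s < Num.sqrt t by rewrite ltr_sqrt.
have s10 : 0 < Num.sqrt s - 1 by rewrite subr_gt0.
have t10 : 0 < Num.sqrt t - 1 by rewrite subr_gt0 (lt_trans q1).
rewrite /eta0; apply: ltr_leD.
  by rewrite ltf_pV2 ?posrE ?sqrtr_gt0.
apply: ler_wpM2r; first by rewrite divr_ge0 ?unit_ball_vol_ge0.
apply: ler_wpM2r => //; apply: ler_wpM2l => //.
by rewrite lef_pV2 ?posrE// lerD2r ltW.
Qed.

(** * Choice of the constants and assembly *)

Unset Implicit Arguments.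

Theorem theorem2p1 (R : realType) (k : nat) (L beta : R)
  (Phi0 : 'rV[R]_k -> R) (sigma Sk C1 C2 gam : R) :
  (2 <= k)%N -> 0 < L -> 0 < beta ->
  C2_scal (ocube (L + beta)) Phi0 ->
  1 < Sk -> eta0 k Sk (k + 2)%:R = 1 -> Sk < sigma ->
  1 < C1 -> 1 < C2 ->
  0 < gam -> gam ^- 2 = C1 * sigma ->
  (forall x, ocube (L + beta) x -> forall i : 'I_k, (i : nat) = 0%N ->
     C1 ^+ k.-1 * C2 * sigma ^+ k <= (pd i Phi0 x) ^+ 2) ->
  (forall x, ocube (L + beta) x -> forall i : 'I_k, (0 < i)%N ->
     (pd i Phi0 x) ^+ 2 <= (C1 - 1) * (C2 - 1) / (k.-1)%:R * sigma) ->
  exists r0 eps_m K eps0 : R,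
    [/\ 0 < r0, 0 < eps_m, 0 < K & 0 < eps0] /\
    forall theta : R,
    let U := Uj gam L Phi0 theta in
    let T := Tj gam L Phi0 theta in
    let V := fun j : int => nbhd_set eps_m (U j) in
    let J := [set j : int | U j !=set0] in
    [/\ (* J is finite *)
        finite_set J /\
        (* (PRE) *)
        (forall j, J j ->
           [/\ eopen (U j), U j `<=` Omega gam L,
               eclosure (U j) `<=` V j,
               V j `<=` Omega_r gam L beta
             & C2_on (V j) (T j)]) /\
        (forall j j', J j -> J j' -> j <> j' -> U j `&` U j' = set0),
        (* (PE1) *)
        (forall j, J j ->
           (forall u, U j u -> Ttheta gam L Phi0 theta u = T j u) /\
           nbhd_set r0 (Ttheta gam L Phi0 theta @` U j) `<=` T j @` V j),
        (* (PE2) and (PE4) *)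
        (forall j, J j ->
           [/\ {in V j &, injective (T j)}, eopen (T j @` V j)
             & exists g : 'rV[R]_k -> 'rV[R]_k,
               [/\ forall u, V j u -> g (T j u) = u,
                   C2_on (T j @` V j) g,
                   (forall eps : R, 0 < eps < eps0 ->
                    forall z, (T j @` V j) z ->
                    forall x y, eball z eps x -> (T j @` V j) x ->
                                eball z eps y -> (T j @` V j) y ->
                    `|jac g x - jac g y| <= K * `|jac g z| * eps)
                 & (forall u v, (T j @` V j) u -> (T j @` V j) v ->
                    eucl_dist u v <= eps0 ->
                    eucl_dist (g u) (g v) <= (Num.sqrt sigma)^-1 * eucl_dist u v)]]),
        (* (PE3) *)
        leb_outer (Omega gam L `\` \bigcup_(j in J) U j) = 0%E
      & (* (PE5) *)
        (ereal_sup [set eta_fn gam L Phi0 theta sigma eps_m delta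
                   | delta in [set d : R | 0 < d <= eps0]%R] < 1)%E].
Proof.
case: k Phi0 => [|[|n]] Phi0 // _ L0 beta0 smooth Sk1 etaSk Sksigma C11 C21 gam0 gamE.
move=> pd0 pdi; have sigma1 := lt_trans Sk1 Sksigma.
have pd0' x (hx : ocube (L + beta) x) := pd0 x hx ord0 erefl.
have eta1 : eta0 n.+2 sigma (n.+2 + 2)%:R < 1.
  by have := @eta0_decreasing R n.+2 Sk sigma _ Sk1 Sksigma (ler0n _ (n.+2 + 2)); rewrite etaSk.
have [M [M1 bF1 bF2]] := derivative_bounds L0 beta0 smooth sigma1 C11 gam0 gamE.
(* None of the four constants depends on [theta], since [M] bounds derivatives of [F], in which
   [theta] does not enter. *)
exists (onto_radius n M * eps_m n beta gam), (eps_m n beta gam).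
exists (2 * n.+2%:R * M ^+ 2), (eps_0 n L gam M); split.
  have em0 := eps_m_gt0 n beta0 gam0.
  split=> //; first by rewrite mulr_gt0// onto_radius_gt0.
    by rewrite !mulr_gt0//; exact: lt_le_trans M1.
  exact: eps_0_gt0.
move=> theta; split.
- exact: (partition_pre L0 beta0 smooth sigma1 C11 gam0 gamE M1 bF1).
- move=> j _; split=> [u|]; first exact: (Ttheta_U L0).
  exact: (Ttheta_U_nbhd L0 beta0 smooth sigma1 C11 C21 gam0 gamE pd0' pdi M1 bF1).
- move=> j _.
  exact: (branch_properties beta0 smooth sigma1 C11 C21 gam0 gamE pd0' pdi M1 bF1 bF2).
- exact: (partition_full L0 beta0 smooth sigma1 C11 C21 gam0 gamE pd0' pdi).
- exact: (eta_sup_lt1 L0 beta0 smooth sigma1 C11 C21 gam0 gamE pd0' pdi M1 bF1).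
Qed.
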